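(* Let $m,n$ be nonzero integers. Then the Baumslag--Solitar group $BS(m,n) = \langle a,t \mid t a^m t^{-1} = a^n\rangle$ is not $\mathbb{Q}\mathbf{CF}$.
   Context: All generating sets are finite and symmetric (closed under inverses). For a group $G$ with finite generating set $S$, $d_S(g)$ denotes the word length of $g \in G$ with respect to $S$. A word $w \in S^*$ of length $|w|$ is also regarded as the element of $G$ it represents. A word $w\in S^*$ is $(\lambda,\epsilon)$-quasigeodesic in the Cayley graph $\Gamma(G,S)$ if $|u| \le \lambda d_S(u) + \epsilon$ for every contiguous subword $u$ of $w$. A finitely generated group $G$ is $\mathbb{Q}\mathbf{CF}$ if for all rational $\lambda \ge 1$, all real $\epsilon \ge 0$ and all finite generating sets $S$ of $G$, the set of $(\lambda,\epsilon)$-quasigeodesic words in $\Gamma(G,S)$ is a context-free language over $S$. *)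

(* Defs.v *)
From HB Require Import structures.
From mathcomp Require Import all_boot all_order all_algebra finmap.
From mathcomp Require Import boolp classical_sets reals.
From Stdlib Require Import Relation_Operators.
Set Implicit Arguments.
Unset Strict Implicit.
Unset Printing Implicit Defensive.
Import Order.TTheory GRing.Theory Num.Theory.

Local Open Scope ring_scope.
Local Open Scope quotient_scope.

Record cfg (T : finType) := Cfg {
  nonterm : finType;
  start : nonterm;
  rules : seq (nonterm * seq (nonterm + T)) }.

Section Cfg.
Variables (T : finType) (G : cfg T).

Variant cfg_step : seq (nonterm G + T) -> seq (nonterm G + T) -> Prop :=
  CfgStep (A : nonterm G) (rhs u v : seq (nonterm G + T)) :
    (A, rhs) \in rules G -> cfg_step (u ++ inl A :: v) (u ++ rhs ++ v).

Definition cfg_language : set (seq T) :=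
  [set w | clos_refl_trans _ cfg_step [:: inl (start G)] [seq inr x | x <- w]].

End Cfg.

Definition context_free (T : finType) (L : set (seq T)) : Prop :=
  exists G : cfg T, L = cfg_language G.

Section Words.
Variables (G : groupType) (S : {fset G}).

Definition word_val (w : seq S) : G := (\prod_(s <- w) val s)%g.

Definition symmetric_generating : Prop :=
  (forall s, s \in S -> (s^-1)%g \in S) /\ (forall g, exists w, word_val w = g).

Definition word_of_size (g : G) (n : nat) : bool :=
  `[< exists w : seq S, size w = n /\ word_val w = g >].

(* The word length of [g]; the junk value 0 is only used when [g] is not a
   product of elements of [S], which never happens if [S] generates [G]. *)
Definition word_length (g : G) : nat :=
  if pselect (exists n, word_of_size g n) is left ex then ex_minn ex else 0%N.

Definition quasigeodesic (R : realType) (lambda : rat) (eps : R) (w : seq S) :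
    Prop :=
  forall u, infix u w ->
    (size u)%:R <= ratr lambda * (word_length (word_val u))%:R + eps.

End Words.

(* No finite generation hypothesis is included: the condition is vacuous when no
   finite set generates [G], so [~ QCF R G] implies that [G] is finitely
   generated. *)
Definition QCF (R : realType) (G : groupType) : Prop :=
  forall (lambda : rat) (eps : R) (S : {fset G}),
    1 <= lambda -> 0 <= eps -> symmetric_generating S ->
    context_free [set w : seq S | quasigeodesic lambda eps w].

(* The letter [(x, b)] stands for [x] if [b = false], for [x^-1] if [b = true].
   A presentation consists of a set [eqn] of equations between words, and
   [pres_eq] is the congruence that they generate together with the cancellation
   rules [x x^-1 = x^-1 x = 1]. *)
Section Presentation.
Variables (X : choiceType) (eqn : seq (X * bool) -> seq (X * bool) -> Prop).
Implicit Types u v w : seq (X * bool).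

Inductive pres_eq : seq (X * bool) -> seq (X * bool) -> Prop :=
| pres_eqn u v : eqn u v -> pres_eq u v
| pres_cancel x b : pres_eq [:: (x, b); (x, ~~ b)] [::]
| pres_cat u u' v v' : pres_eq u u' -> pres_eq v v' ->
    pres_eq (u ++ v) (u' ++ v')
| pres_refl u : pres_eq u u
| pres_sym u v : pres_eq u v -> pres_eq v u
| pres_trans v u w : pres_eq u v -> pres_eq v w -> pres_eq u w.

Definition pres_eqb u v := `[< pres_eq u v >].

Lemma pres_eqb_refl : reflexive pres_eqb.
Proof. by move=> u; apply/asboolP/pres_refl. Qed.

Lemma pres_eqb_sym : symmetric pres_eqb.
Proof. by move=> u v; apply/asboolP/asboolP => /pres_sym. Qed.

Lemma pres_eqb_trans : transitive pres_eqb.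
Proof.
by move=> v u w /asboolP uv /asboolP vw; apply/asboolP/(pres_trans uv vw).
Qed.

Canonical pres_equiv :=
  EquivRel pres_eqb pres_eqb_refl pres_eqb_sym pres_eqb_trans.

Definition presented_group : Type := {eq_quot pres_equiv}.

HB.instance Definition _ := Choice.on presented_group.
HB.instance Definition _ := EqQuotient.on presented_group.

Definition pres_class w : presented_group := \pi_presented_group w.

Lemma pres_classP u v : pres_class u = pres_class v <-> pres_eq u v.
Proof.
by split=> [/eqmodP/asboolP //|?]; apply/eqmodP/asboolP.
Qed.

Lemma pres_classK (g : presented_group) : pres_class (repr g) = g.
Proof. exact: reprK. Qed.

Definition inv_word w := rev [seq (p.1, ~~ p.2) | p <- w].

Lemma inv_wordK : involutive inv_word.
Proof.
move=> w; rewrite /inv_word map_rev revK -map_comp -[RHS]map_id.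
by apply: eq_map => -[x b] /=; rewrite negbK.
Qed.

Lemma inv_word_cat u v : inv_word (u ++ v) = inv_word v ++ inv_word u.
Proof. by rewrite /inv_word map_cat rev_cat. Qed.

Lemma inv_word_mulr w : pres_eq (w ++ inv_word w) [::].
Proof.
elim: w => [|[x b] w IH]; first exact: pres_refl.
rewrite -cat1s inv_word_cat -catA (catA w).
apply: pres_trans (pres_cancel x b); rewrite -[X in pres_eq _ X]cat1s.
apply: pres_cat; first exact: pres_refl.
by rewrite -[X in pres_eq _ X]cat0s; apply: pres_cat => //; apply: pres_refl.
Qed.

Lemma inv_word_mull w : pres_eq (inv_word w ++ w) [::].
Proof. by have := inv_word_mulr (inv_word w); rewrite inv_wordK. Qed.

Lemma inv_word_eq u v : pres_eq u v -> pres_eq (inv_word u) (inv_word v).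
Proof.
move=> uv; have := pres_cat (pres_refl (inv_word u)) (inv_word_mulr v).
rewrite cats0; move/pres_sym/pres_trans; apply; rewrite catA.
rewrite -[X in pres_eq _ X]cat0s; apply: pres_cat; last exact: pres_refl.
apply: pres_trans (inv_word_mull u).
by apply: pres_cat; [apply: pres_refl|apply: pres_sym].
Qed.

Definition pres_mul (g h : presented_group) := pres_class (repr g ++ repr h).
Definition pres_inv (g : presented_group) := pres_class (inv_word (repr g)).

Lemma pres_mulE u v : pres_mul (pres_class u) (pres_class v) =
  pres_class (u ++ v).
Proof. by apply/pres_classP/pres_cat; apply/pres_classP; rewrite pres_classK. Qed.

Lemma pres_invE u : pres_inv (pres_class u) = pres_class (inv_word u).
Proof. by apply/pres_classP/inv_word_eq/pres_classP; rewrite pres_classK. Qed.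

Lemma pres_mulA : associative pres_mul.
Proof.
move=> g h k; rewrite -(pres_classK g) -(pres_classK h) -(pres_classK k).
by rewrite !pres_mulE catA.
Qed.

Lemma pres_mul1 : left_id (pres_class [::]) pres_mul.
Proof. by move=> g; rewrite -(pres_classK g) pres_mulE. Qed.

Lemma pres_mulV : left_inverse (pres_class [::]) pres_inv pres_mul.
Proof.
move=> g; rewrite -(pres_classK g) pres_invE pres_mulE.
exact/pres_classP/inv_word_mull.
Qed.

Lemma pres_invK : involutive pres_inv.
Proof. by move=> g; rewrite -(pres_classK g) !pres_invE inv_wordK. Qed.

Lemma pres_invM : {morph pres_inv : g h / pres_mul g h >-> pres_mul h g}.
Proof.
move=> g h; rewrite -(pres_classK g) -(pres_classK h).
by rewrite pres_mulE !pres_invE pres_mulE inv_word_cat.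
Qed.

HB.instance Definition _ := isStarMonoid.Build presented_group
  pres_mulA pres_mul1 pres_invK pres_invM.
HB.instance Definition _ := StarMonoid_isGroup.Build presented_group pres_mulV.

Definition letter_val (H : groupType) (f : X -> H) (p : X * bool) : H :=
  if p.2 then ((f p.1)^-1)%g else f p.1.

Lemma pres_class_prod w :
  pres_class w = (\prod_(p <- w) letter_val (fun x => pres_class [:: (x, false)]) p)%g.
Proof.
elim: w => [|[x b] w IH]; first by rewrite big_nil.
rewrite big_cons -IH -[LHS]/(pres_class ([:: (x, b)] ++ w)) -pres_mulE.
congr pres_mul; rewrite /letter_val /=; case: b => //.
by symmetry; apply: pres_invE.
Qed.

(* With [pres_class_prod] and [pres_eqn], this is the universal property of the
   presented group. *)
Lemma pres_eq_val (H : groupType) (f : X -> H) :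
  (forall u v, eqn u v ->
     (\prod_(p <- u) letter_val f p = \prod_(p <- v) letter_val f p)%g) ->
  forall u v, pres_eq u v ->
     (\prod_(p <- u) letter_val f p = \prod_(p <- v) letter_val f p)%g.
Proof.
move=> fP u v; elim=> // {u v}.
- move=> x b; rewrite big_cons big_seq1 big_nil /letter_val /=.
  by case: b; rewrite ?mulVg ?mulgV.
- by move=> u u' v v' _ uu' _ vv'; rewrite !big_cat /= uu' vv'.
- by move=> v u w _ -> _ ->.
Qed.

End Presentation.

Definition bs_a : bool := false.
Definition bs_t : bool := true.

Definition word_pow (X : Type) (x : X) (k : int) : seq (X * bool) :=
  nseq `|k|%N (x, k < 0).

Variant bs_rel (m n : int) : seq (bool * bool) -> seq (bool * bool) -> Prop :=
  BsRel : bs_rel m n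
    (word_pow bs_t 1 ++ word_pow bs_a m ++ word_pow bs_t (-1)) (word_pow bs_a n).

Definition BS (m n : int) : groupType := presented_group (bs_rel m n).

(* Main.v *)
(* An infix-closed context-free language containing a word [al x^p be], with [p]
   large, contains all the words [al x^k] or all the words [x^k be], because Ogden's
   lemma pumps inside the block [x^p] on one side of it.  So it suffices to find
   uniformly quasigeodesic words [al x^p be], with [p] arbitrary, such that
   [al x^k] and [x^l be] contain long detours for some [k] and [l].

   If [|m| = |n|], then [t^2] and [a^m] commute, and
   [al = a^-l t^j], [x = a], [be = t^j a^-l] will do, where [l >> j >> p].
   If [|m| < |n|] (otherwise exchange [t] and [t^-1]), there are words
   [down i = a^d0 t^-1 a^d1 t^-1 ...] with [i] letters [t^-1] and bounded digits such
   that [t^i down i] is a power of [a], with exponent of order [|n / m|^i].  As it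
   commutes with [a], the word [al = t^i down i a (down i)^-1] equals [a t^i], and
   [x = t^-1], [be = a^-1 al] will do, where [i >> p]: one has [al x^i = a] and
   [x^i be = 1].

   Lower bounds for the word length come from the action of [a] and [t] on the
   rational line as [x |-> x + 1] and [x |-> q x], with [q = n / m] up to sign: an
   element of word length [k] multiplies by [q^h] with [|h| <= k] and translates by
   a rational number whose absolute value and whose denominator are at most
   exponential in [k]. *)
Require Import Defs.
From HB Require Import structures.
From mathcomp Require Import all_boot all_order all_algebra finmap.
From mathcomp Require Import boolp classical_sets reals.
From mathcomp Require Import zify ring lra.
From Stdlib Require Import Relation_Operators.
Set Implicit Arguments.
Unset Strict Implicit.
Unset Printing Implicit Defensive.
Import Order.TTheory GRing.Theory Num.Theory.

(** * A block pumping lemma for context-free languages *)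

Local Open Scope nat_scope.

Section Derivations.
Variables (T : finType) (G : cfg T).
Implicit Types (s : seq (nonterm G + T)) (w : seq T).

Definition derives := clos_refl_trans _ (@cfg_step T G).

Definition terminals w : seq (nonterm G + T) := [seq inr x | x <- w].

(** Steps are counted because [block_pump] descends by induction on their number. *)
Inductive derives_in : nat -> seq (nonterm G + T) -> seq (nonterm G + T) -> Prop :=
| derives_in0 s : derives_in 0 s s
| derives_inS n s s' s'' :
    cfg_step s s' -> derives_in n s' s'' -> derives_in n.+1 s s''.

Lemma derives_inP s s' : derives s s' <-> exists n, derives_in n s s'.
Proof.
split.
  move=> ss'; have [n ss'n] : exists n, forall s'' m,
      derives_in m s' s'' -> derives_in (n + m) s s''.
    elim: ss' => {s s'} [s s' ss'|s|s s1 s2 _ [n IHn] _ [m IHm]].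
    - by exists 1 => s'' m /(derives_inS ss').
    - by exists 0.
    - by exists (n + m) => s'' k /IHm /IHn; rewrite addnA.
  by exists (n + 0); apply: ss'n; apply: derives_in0.
move=> [n]; elim=> {n s s'} [s|n s s1 s2 ss1 _ IH]; first exact: rt_refl.
exact: rt_trans (rt_step _ _ _ _ ss1) IH.
Qed.

Lemma derives_ctx u v s s' : derives s s' -> derives (u ++ s ++ v) (u ++ s' ++ v).
Proof.
elim=> {s s'} [_ _ [A rhs s1 s2 Ar]|s|s s1 s2 _ IH1 _ IH2].
- rewrite -!catA /= -cat_cons !catA -(catA (u ++ s1) rhs) -!(catA (u ++ s1)).
  by rewrite -(catA rhs) cat_cons; apply/rt_step/CfgStep.
- exact: rt_refl.
- exact: rt_trans IH1 IH2.
Qed.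

Lemma cfg_step_inv s s' : cfg_step s s' -> exists A rhs u v,
  [/\ (A, rhs) \in rules G, s = u ++ inl A :: v & s' = u ++ rhs ++ v].
Proof. by case=> A rhs u v Ar; exists A, rhs, u, v. Qed.

Lemma cat_eq_cat_cons (X : Type) (s1 s2 u v : seq X) x :
  s1 ++ s2 = u ++ x :: v ->
  (exists2 v', s1 = u ++ x :: v' & v = v' ++ s2) \/
  (exists2 u', u = s1 ++ u' & s2 = u' ++ x :: v).
Proof.
elim: s1 u => [|y s1 IH] [|z u] /=.
- by move=> ->; right; exists [::].
- by move=> ->; right; exists (z :: u).
- by case=> -> <-; left; exists s1.
- case=> -> /IH[[v' -> ->]|[u' -> ->]]; first by left; exists v'.
  by right; exists u'.
Qed.


Lemma derives_in_invS n s s'' : derives_in n.+1 s s'' ->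
  exists2 s', cfg_step s s' & derives_in n s' s''.
Proof.
move eq_k: n.+1 => k der.
by case: der eq_k => [s0|m s1 s2 s3 s12 s23] // [->]; exists s2.
Qed.

Lemma derives_in_inv0 s s' : derives_in 0 s s' -> s = s'.
Proof. by move eq_k: 0 => k der; case: der eq_k. Qed.

(** Each step rewrites a nonterminal of one of the two halves, so the steps can be sorted by
    half. *)
Lemma derives_in_cat n s1 s2 w : derives_in n (s1 ++ s2) (terminals w) ->
  exists n1 n2 w1 w2, [/\ n = n1 + n2, w = w1 ++ w2,
    derives_in n1 s1 (terminals w1) & derives_in n2 s2 (terminals w2)].
Proof.
elim: n s1 s2 => [|n IH] s1 s2.
  move=> /derives_in_inv0 eq_s.
  exists 0, 0, (take (size s1) w), (drop (size s1) w).
  rewrite cat_take_drop /terminals map_take map_drop -/(terminals w) -eq_s.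
  by rewrite take_size_cat // drop_size_cat //; split=> //; apply: derives_in0.
move=> /derives_in_invS[s' /cfg_step_inv[A [rhs [u [v [Ar eq_s ->]]]]]].
case: (cat_eq_cat_cons eq_s) => [[v' -> ->]|[u' -> ->]].
  rewrite 2!catA -(catA u) => /IH[n1 [n2 [w1 [w2 [-> -> d1 d2]]]]].
  exists n1.+1, n2, w1, w2; split=> //.
  by apply: derives_inS d1; apply: CfgStep.
rewrite -catA => /IH[n1 [n2 [w1 [w2 [-> -> d1 d2]]]]].
exists n1, n2.+1, w1, w2; split=> //; first by rewrite addnS.
by apply: derives_inS d2; apply: CfgStep.
Qed.

Lemma derives_in_term n x w : derives_in n [:: inr x] (terminals w) -> w = [:: x].
Proof.
case: n => [/derives_in_inv0|n /derives_in_invS[s' st _]].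
  by case: w => // y w [->]; case: w.
by have [A [rhs [u [v [_]]]]] := cfg_step_inv st; case: u => // ? [].
Qed.

Lemma derives_in_nt n A w : derives_in n [:: inl A] (terminals w) ->
  exists rhs n', [/\ (A, rhs) \in rules G, n = n'.+1
    & derives_in n' rhs (terminals w)].
Proof.
case: n => [/derives_in_inv0|n /derives_in_invS[s' st der]].
  by case: w.
have [B [rhs [u [v [Br]]]]] := cfg_step_inv st.
case: u => [|? []] // [eqAB <-] eq_s; move: der; rewrite eq_s cats0 eqAB.
by exists rhs, n.
Qed.

(* [overlap] is the number of positions of a factor starting at [o], of length [l],
   which lie in the window [[a, b)]. *)
Definition overlap (a b o l : nat) := minn (o + l) b - maxn o a.

(** [overlap] is additive over consecutive factors, so some symbol of [rhs] carries at least the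
    fraction [1 / size rhs] of it. *)
Lemma derives_in_heavy a b o n rhs w : derives_in n rhs (terminals w) ->
  0 < overlap a b o (size w) ->
  exists s1 c s2 w1 wc w2 nc,
    [/\ rhs = s1 ++ c :: s2, w = w1 ++ wc ++ w2,
        derives s1 (terminals w1), derives s2 (terminals w2)
      & [/\ derives_in nc [:: c] (terminals wc), nc <= n
      & overlap a b o (size w) <= size rhs * overlap a b (o + size w1) (size wc)]].
Proof.
elim: rhs o n w => [|c rhs IH] o n w der ov_gt0.
  case: n der => [/derives_in_inv0|n /derives_in_invS[s' st _]].
    by case: w ov_gt0 => //=; rewrite /overlap; lia.
  by have [A [rhs [u [v [_]]]]] := cfg_step_inv st; case: u.
move: der; rewrite -cat1s => /derives_in_cat[n1 [n2 [w1 [w2 [-> eq_w d1 d2]]]]].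
have ovD : overlap a b o (size w) =
    overlap a b o (size w1) + overlap a b (o + size w1) (size w2).
  by rewrite eq_w size_cat /overlap; lia.
have [ov2|ov2] := posnP (overlap a b (o + size w1) (size w2)).
  exists [::], c, rhs, [::], w1, w2, n1; split=> //.
  - exact: rt_refl.
  - by apply/derives_inP; exists n2.
  - by split=> //; [lia|rewrite ovD ov2 /= mulSn !addn0 leq_addr].
have [s1 [d [s2 [v1 [vd [v2 [nd [eq_rhs eq_w2 ds1 ds2 [dd le_nd le_ov]]]]]]]]] :=
  IH _ _ _ d2 ov2.
have [le1|gt1] := leqP (overlap a b o (size w1))
    (overlap a b (o + size w1 + size v1) (size vd)).
  exists (c :: s1), d, s2, (w1 ++ v1), vd, v2, nd; split=> //.
  - by rewrite eq_rhs.
  - by rewrite eq_w eq_w2 !catA.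
  - have dc : derives [:: c] (terminals w1) by apply/derives_inP; exists n1.
    have := derives_ctx [::] s1 dc; rewrite /= => h; apply: rt_trans h _.
    rewrite /terminals map_cat.
    by have := derives_ctx (terminals w1) [::] ds1; rewrite !cats0.
  - by split=> //; [lia|rewrite ovD /= mulSn size_cat addnA leq_add].
exists [::], c, rhs, [::], w1, w2, n1; split=> //.
- exact: rt_refl.
- by apply/derives_inP; exists n2.
- split=> //; first lia.
  rewrite ovD addn0 /= mulSn leq_add2l.
  by apply: leq_trans le_ov _; rewrite leq_mul2l ltnW ?orbT.
Qed.

(** * Paths in derivation trees *)

Definition sym := (nonterm G + T)%type.
Implicit Types (A B : nonterm G) (c d : sym) (u v y z : seq T).

(** A path from [c] down to [d] in a derivation tree, with yields [v] on its left and [y] on its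
    right. *)
Definition embeds c v d y := derives [:: c] (terminals v ++ d :: terminals y).

Lemma terminals_cat v y : terminals (v ++ y) = terminals v ++ terminals y.
Proof. exact: map_cat. Qed.

Lemma embeds_trans c d e v y v' y' : embeds c v d y -> embeds d v' e y' ->
  embeds c (v ++ v') e (y' ++ y).
Proof.
move=> cd /(derives_ctx (terminals v) (terminals y)) de.
by rewrite /embeds !terminals_cat; apply: rt_trans cd _; move: de; rewrite /= -!catA.
Qed.

Lemma embeds_yield c d v y w : embeds c v d y -> derives [:: d] (terminals w) ->
  derives [:: c] (terminals (v ++ w ++ y)).
Proof.
move=> cd /(derives_ctx (terminals v) (terminals y)) dw.
by rewrite !terminals_cat; apply: rt_trans cd _; move: dw.
Qed.

Lemma embeds_iter c v y k : embeds c v c y ->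
  embeds c (flatten (nseq k v)) c (flatten (nseq k y)).
Proof.
move=> cc; elim: k => [|k IH]; first exact: rt_refl.
have -> : flatten (nseq k.+1 y) = flatten (nseq k y) ++ y.
  by rewrite -[k.+1]addn1 nseqD flatten_cat /= cats0.
exact: embeds_trans cc IH.
Qed.

Definition pumps (W : seq T) (P : seq T -> seq T -> seq T -> seq T -> Prop) :=
  exists A u v w y z, [/\ W = u ++ (v ++ w ++ y) ++ z, P u v y z,
    embeds (inl (start G)) u (inl A) z, embeds (inl A) v (inl A) y
  & derives [:: inl A] (terminals w)].

(** [A] lies on the path from the start symbol to [d]; if [d] is [A] again, then [v] and [y] can be
    pumped. *)
Definition ancestor A d u z (P : seq T -> seq T -> seq T -> seq T -> Prop) :=
  exists u1 v y z1, [/\ u = u1 ++ v, z = y ++ z1, P u1 v y z1,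
    embeds (inl (start G)) u1 (inl A) z1 & embeds (inl A) v d y].

Lemma ancestor_ctx A c d u v y z (P Q : seq T -> seq T -> seq T -> seq T -> Prop) :
  (forall u1 v1 y1 z1, P u1 v1 y1 z1 -> Q u1 (v1 ++ v) (y ++ y1) z1) ->
  embeds c v d y -> ancestor A c u z P -> ancestor A d (u ++ v) (y ++ z) Q.
Proof.
move=> PQ cd [u1 [v1 [y1 [z1 [-> -> /PQ Q1 ctx1 ctx2]]]]].
exists u1, (v1 ++ v), (y ++ y1), z1; split=> //; rewrite ?catA //.
exact: embeds_trans ctx2 cd.
Qed.

(* Ogden's lemma for the block of positions [[a, b)] of [W].  Along the path that
   follows the heaviest child, [X] and [Y] collect the nonterminals above which
   the path has lost block positions on the left, resp. on the right; such a
   nonterminal can be repeated only if it gives a pump inside the block. *)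
Lemma block_pump a b r W n c u w z (X Y : {set nonterm G}) :
  let inl_block u v y z := a <= size u /\ 0 < size v in
  let inr_block u v y z := size W - b <= size z /\ 0 < size y in
  (forall A rhs, (A, rhs) \in rules G -> size rhs <= r) -> 0 < r ->
  b <= size W ->
  W = u ++ w ++ z -> embeds (inl (start G)) u c z ->
  derives_in n [:: c] (terminals w) ->
  (forall A, A \in X -> ancestor A c u z inl_block) ->
  (forall A, A \in Y -> ancestor A c u z inr_block) ->
  [\/ pumps W (fun u v y z => [/\ a <= size u, 0 < size v & size u + size v <= b]),
      pumps W (fun u v y z => [/\ size W - b <= size z, 0 < size y
                                & size z + size y <= size W - a])
    | overlap a b (size u) (size w) <= r ^ ((#|nonterm G| - #|X|) + (size u < a)
        + (#|nonterm G| - #|Y|) + (size z < size W - b))].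
Proof.
move=> lblock rblock le_r r_gt0 leb.
have [m] := ubnP n; elim: m n c u w z X Y => // m IH n c u w z X Y le_nm.
move=> eqW ctx der Xp Yp.
have [ov0|ov_gt0] := posnP (overlap a b (size u) (size w)).
  by constructor 3; rewrite ov0.
case: c ctx der Xp Yp => [B|x] ctx der Xp Yp; last first.
  constructor 3; rewrite (derives_in_term der).
  by apply: (@leq_trans 1); rewrite ?expn_gt0 ?r_gt0 // /overlap /=; lia.
have sizeW : size W = size u + size w + size z by rewrite eqW !size_cat addnA.
have dB : derives [:: inl B] (terminals w) by apply/derives_inP; exists n.
(* A repetition of [B] pumps [v], which ends before the block does because the current factor still
   meets the block. *)
have [BX|BX] := boolP (B \in X).
  have [u1 [v [y [z1 [eq_u eq_z [le_a v_gt0] ctx1 ctx2]]]]] := Xp _ BX.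
  constructor 1; exists B, u1, v, w, y, z1; split=> //.
    by rewrite eqW eq_u eq_z -!catA.
  by split=> //; move: ov_gt0; rewrite eq_u size_cat /overlap; lia.
have [BY|BY] := boolP (B \in Y).
  have [u1 [v [y [z1 [eq_u eq_z [le_a v_gt0] ctx1 ctx2]]]]] := Yp _ BY.
  constructor 2; exists B, u1, v, w, y, z1; split=> //.
    by rewrite eqW eq_u eq_z -!catA.
  by split=> //; move: ov_gt0 sizeW; rewrite eq_z size_cat /overlap; lia.
have [rhs [n' [Br eq_n der']]] := derives_in_nt der.
have [s1 [d [s2 [w1 [wd [w2 [nd [eq_rhs eq_w ds1 ds2 [dd le_nd le_ov]]]]]]]]] :=
  derives_in_heavy der' ov_gt0.
have Bd : embeds (inl B) w1 d w2.
  apply: (rt_trans _ _ _ rhs).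
    by apply: rt_step; have := CfgStep [::] [::] Br; rewrite /= cats0.
  rewrite eq_rhs; apply: rt_trans (derives_ctx [::] (d :: s2) ds1) _; rewrite /=.
  have := derives_ctx (terminals w1 ++ [:: d]) [::] ds2.
  by rewrite !cats0 -!catA.
(* [B] is recorded only if the path is past that edge of the block and loses letters on that
   side. *)
pose X' := if (a <= size u) && (0 < size w1) then B |: X else X.
pose Y' := if (size W - b <= size z) && (0 < size w2) then B |: Y else Y.
have := IH nd d (u ++ w1) wd (w2 ++ z) X' Y'; case.
- by rewrite eq_n in le_nm; lia.
- by rewrite eqW eq_w -!catA.
- exact: embeds_trans ctx Bd.
- by [].
- move=> A; rewrite /X'; case: ifP => [/andP[le_au w1_gt0]|_] AX.
    case/setU1P: AX => [->|/Xp]; first by exists u, w1, w2, z.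
    by apply: ancestor_ctx Bd => u1 v1 y1 z1 [? ?]; split=> //; rewrite size_cat ltn_addr.
  apply: ancestor_ctx Bd (Xp _ AX) => u1 v1 y1 z1 [? ?].
  by split=> //; rewrite size_cat ltn_addr.
- move=> A; rewrite /Y'; case: ifP => [/andP[le_au w1_gt0]|_] AY.
    case/setU1P: AY => [->|/Yp]; first by exists u, w1, w2, z.
    by apply: ancestor_ctx Bd => u1 v1 y1 z1 [? ?]; split=> //; rewrite size_cat ltn_addl.
  apply: ancestor_ctx Bd (Yp _ AY) => u1 v1 y1 z1 [? ?].
  by split=> //; rewrite size_cat ltn_addl.
- by constructor 1.
- by constructor 2.
move=> le_ov'; constructor 3.
have cardX' : #|X'| = #|X| + ((a <= size u) && (0 < size w1)).
  by rewrite /X'; case: ifP => _; rewrite ?addn0 // cardsU1 BX addnC.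
have cardY' : #|Y'| = #|Y| + ((size W - b <= size z) && (0 < size w2)).
  by rewrite /Y'; case: ifP => _; rewrite ?addn0 // cardsU1 BY addnC.
have := max_card X'; have := max_card Y'.
rewrite cardX' cardY' in le_ov' *.
move: le_ov'; set e' := (X in _ ^ X); set e := (X in _ -> _ -> _ -> _ <= _ ^ X).
rewrite !size_cat in e' * => le_ov' maxY maxX.
(* The exponent bounds how often block letters can still be lost: once per unrecorded nonterminal on
   each side, and once when each edge is crossed. If it drops, the heavy child costs a factor [r];
   otherwise no block letter is lost. *)
have [lt_e|ge_e] := ltnP e' e.
  apply: leq_trans le_ov _; apply: (@leq_trans (r * r ^ e')).
    exact: leq_mul (le_r _ _ Br) le_ov'.
  by rewrite -expnS leq_pexp2l.
have eq_ov : overlap a b (size u) (size w) = overlap a b (size u + size w1) (size wd).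
  have [eq_l eq_r] : maxn (size u) a = maxn (size u + size w1) a /\
      maxn (size z) (size W - b) = maxn (size w2 + size z) (size W - b).
    move: ge_e maxX maxY; rewrite /e /e'; clear.
    move: #|nonterm G| #|X| #|Y| (size u) (size w1) (size w2) (size z) (size W - b).
    move=> cN cX cY su sw1 sw2 sz sWb.
    case: (leqP a su) (ltnP (su + sw1) a) => ? [] ?; case: (posnP sw1) => ?;
    case: (leqP sWb sz) (ltnP (sw2 + sz) sWb) => ? [] ?; case: (posnP sw2) => ?;
    by rewrite /=; lia.
  have eq_sw : size w = size w1 + size wd + size w2 by rewrite eq_w !size_cat addnA.
  by move: eq_l eq_r sizeW leb; rewrite /overlap eq_sw; clear; lia.
by rewrite eq_ov (leq_trans le_ov') // leq_pexp2l //; move: ge_e; rewrite /e /e'; lia.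
Qed.

End Derivations.

Lemma take_block (T : Type) (al be : seq T) (x : T) p n :
  size al <= n <= size al + p ->
  take n (al ++ nseq p x ++ be) = al ++ nseq (n - size al) x.
Proof.
move=> /andP[le1 le2]; rewrite take_cat ltnNge le1 /=; congr cat.
rewrite take_cat size_nseq; have [lt|ge] := ltnP (n - size al) p.
  by rewrite take_nseq // ltnW.
have -> : n - size al = p by lia.
by rewrite subnn take0 cats0.
Qed.

Lemma drop_block (T : Type) (al be : seq T) (x : T) p n :
  size al <= n <= size al + p ->
  drop n (al ++ nseq p x ++ be) = nseq (p - (n - size al)) x ++ be.
Proof.
move=> /andP[le1 le2]; rewrite drop_cat ltnNge le1 /=.
rewrite drop_cat size_nseq; have [lt|ge] := ltnP (n - size al) p.
  by rewrite drop_nseq.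
have -> : n - size al = p by lia.
by rewrite subnn drop0.
Qed.

Lemma flatten_nseq_nseq (T : Type) (x : T) k s :
  flatten (nseq k (nseq s x)) = nseq (k * s) x.
Proof. by elim: k => //= k ->; rewrite mulSn nseqD. Qed.

(** Pumping the factor inside the block lengthens the run of [x] at will; closure under infixes then
    cuts the run to length [k] and discards what lies beyond it. *)
Theorem context_free_block (T : finType) (L : set (seq T)) : context_free L ->
  (forall u w, infix u w -> L w -> L u) ->
  exists2 p, 0 < p & forall (al be : seq T) x, L (al ++ nseq p x ++ be) ->
    (forall k, L (al ++ nseq k x)) \/ (forall k, L (nseq k x ++ be)).
Proof.
case=> G eqL Linfix.
pose r := (\max_(rl <- rules G) size rl.2).+1.
(* One more than the overlap that the third alternative of [block_pump] permits for empty [X] and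
   [Y]. *)
pose p := (r ^ (#|nonterm G| + 1 + #|nonterm G| + 1)).+1.
exists p => // al be x LW; set W := al ++ _ in LW.
have sizeW : size W = size al + p + size be by rewrite /W !size_cat size_nseq addnA.
have /derives_inP[n der] : derives [:: inl (start G)] (terminals G W).
  by move: LW; rewrite eqL.
have Ld w : derives [:: inl (start G)] (terminals G w) -> L w by rewrite eqL.
have := @block_pump _ G (size al) (size al + p) r W n (inl (start G)) [::] W [::]
  finset.set0 finset.set0; case.
- move=> A rhs Ar; rewrite /r; apply: ltnW; rewrite ltnS.
  exact: (@leq_bigmax_seq _ _ xpredT (fun rl : _ * _ => size rl.2) (A, rhs)).
- by [].
- by rewrite sizeW; lia.
- by rewrite cats0.
- exact: rt_refl.
- exact: der.
- by move=> A; rewrite inE.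
- by move=> A; rewrite inE.
- case=> A [u [v [w [y [z [eqW [le_a v_gt0 le_b] ctx1 ctx2 dw]]]]]]; left => k.
  have sizes : size W = size u + (size v + size w + size y) + size z.
    by rewrite eqW !size_cat !addnA.
  have eq_u : u = al ++ nseq (size u - size al) x.
    rewrite -(@take_block _ al be x p); last by rewrite le_a; lia.
    by rewrite -/W eqW take_size_cat.
  have eq_v : v = nseq (size v) x.
    suff /eqP : u ++ v = u ++ nseq (size v) x.
      by rewrite eqseq_cat // => /andP[_ /eqP].
    rewrite {2}eq_u -catA -nseqD.
    have := @take_block _ al be x p (size u + size v).
    rewrite -/W eqW -!catA catA take_size_cat ?size_cat // => ->; last by lia.
    by congr (_ ++ nseq _ _); lia.
  apply: Linfix (Ld _ (embeds_yield ctx1 (embeds_yield (embeds_iter k ctx2) dw))).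
  rewrite eq_u eq_v flatten_nseq_nseq -!catA (catA (nseq _ x)) -nseqD.
  (* As [v] is not empty, [k] copies of it contain at least [k] letters. *)
  set q := (_ + _); have -> : q = k + (q - k) by rewrite /q; nia.
  by rewrite nseqD -catA catA; apply/infixP; exists [::]; eexists.
- case=> A [u [v [w [y [z [eqW [le_a v_gt0 le_b] ctx1 ctx2 dw]]]]]]; right => k.
  have sizes : size W = size u + (size v + size w + size y) + size z.
    by rewrite eqW !size_cat !addnA.
  have eq_z : z = nseq (size z - size be) x ++ be.
    have := @drop_block _ al be x p (size W - size z).
    rewrite -/W [X in drop _ X]eqW catA drop_size_cat; last first.
      by rewrite !size_cat ?size_nseq; lia.
    move=> eq_z; rewrite {1}eq_z; last by lia.
    by congr (nseq _ _ ++ _); lia.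
  have eq_y : y = nseq (size y) x.
    suff /eqP : y ++ z = nseq (size y) x ++ z.
      by rewrite eqseq_cat ?size_nseq // => /andP[/eqP].
    rewrite {2}eq_z catA -nseqD.
    have := @drop_block _ al be x p (size W - size z - size y).
    rewrite -/W [X in drop _ X]eqW !catA -[X in drop _ X]catA drop_size_cat; last first.
      by rewrite !size_cat ?size_nseq; lia.
    move=> eq_yz; rewrite {1}eq_yz; last by lia.
    by congr (nseq _ _ ++ _); lia.
  apply: Linfix (Ld _ (embeds_yield ctx1 (embeds_yield (embeds_iter k ctx2) dw))).
  rewrite eq_z eq_y flatten_nseq_nseq -!catA (catA (nseq _ x) (nseq _ x)) -nseqD.
  set q := (_ + _); have -> : q = (q - k) + k by rewrite /q; nia.
  rewrite nseqD -!catA !catA -catA; apply/infixP; eexists; exists [::].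
  by rewrite cats0.
move=> le_p; have : p <= r ^ (#|nonterm G| + 1 + #|nonterm G| + 1).
  move: le_p; rewrite !cards0 !subn0 /overlap sizeW /=; set e := (X in r ^ X).
  move=> le_p; apply: leq_trans (_ : _ <= r ^ e) _; first by lia.
  by rewrite leq_pexp2l // /e; lia.
by rewrite /p ltnn.
Qed.

(** * Quasigeodesic words *)

Section Words.
Variables (G : groupType) (S : {fset G}).
Hypothesis symS : symmetric_generating S.
Implicit Types (g : G) (w : seq G).

(** Words are taken over [G], with letters in [S], so that group elements serve directly as letters;
    [lift_word] returns to words over [S]. *)
Definition prodw w : G := (\prod_(g <- w) g)%g.

Lemma prodw_cat w1 w2 : prodw (w1 ++ w2) = (prodw w1 * prodw w2)%g.
Proof. exact: big_cat. Qed.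

Lemma prodw_cons g w : prodw (g :: w) = (g * prodw w)%g.
Proof. exact: big_cons. Qed.

Lemma prodw_nseq g k : prodw (nseq k g) = (g ^+ k)%g.
Proof.
by elim: k => [|k IH]; rewrite /= ?prodw_cons ?IH ?expgS // /prodw big_nil.
Qed.

Lemma word_val_prodw (w : seq S) : word_val w = prodw [seq val s | s <- w].
Proof. by rewrite /prodw big_map. Qed.

Lemma lift_word w : all (mem S) w -> exists w' : seq S, [seq val s | s <- w'] = w.
Proof.
elim: w => [|g w IH] /=; first by exists [::].
by case/andP=> gS /IH[w' <-]; exists ([` gS] :: w')%fset.
Qed.

Lemma word_length_le w : all (mem S) w -> word_length S (prodw w) <= size w.
Proof.
case/lift_word => w' <-; rewrite -word_val_prodw size_map /word_length.
have ww' : word_of_size S (word_val w') (size w') by apply/asboolP; exists w'.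
case: pselect => [ex|[]]; last by exists (size w').
by case: ex_minnP => k _; apply.
Qed.

Lemma word_lengthP g :
  exists w, [/\ all (mem S) w, size w = word_length S g & prodw w = g].
Proof.
rewrite /word_length; case: pselect => [ex|nex]; last first.
  have [w gw] := symS.2 g.
  by case: nex; exists (size w); apply/asboolP; exists w.
case: ex_minnP => k /asboolP[w [<- <-]] _.
exists [seq val s | s <- w]; rewrite size_map word_val_prodw; split=> //.
by apply/allP => _ /mapP[s _ ->]; apply: valP.
Qed.

Variable R : realType.

(** A subword is cut out by two prefixes, and its value is their quotient. The two overlong words
    refute the two alternatives of [context_free_block]. *)
Theorem not_QCF_block (c : nat) (eps : nat) x : 0 < c -> x \in S ->
  (forall p, 0 < p -> exists al be,
    [/\ all (mem S) al, all (mem S) be,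
      let w := al ++ nseq p x ++ be in
      (forall i j, i <= j -> j <= size w -> j - i <=
         c * word_length S ((prodw (take i w))^-1 * prodw (take j w))%g + eps),
      exists k,
        c * word_length S (prodw (al ++ nseq k x)) + eps < size (al ++ nseq k x)
    & exists k,
        c * word_length S (prodw (nseq k x ++ be)) + eps < size (nseq k x ++ be)]) ->
  ~ QCF R G.
Proof.
move=> c_gt0 xS Hp /(_ c%:R%R eps%:R%R S) []//; first by rewrite ler1n.
move=> gram eq_gram.
have qgE (w : seq S) : quasigeodesic c%:R%R (eps%:R : R)%R w <-> forall u, infix u w ->
    size u <= c * word_length S (word_val u) + eps.
  by split=> qg u /qg; rewrite ratr_nat -natrM -natrD ler_nat.
have [p p_gt0 pP] := @context_free_block _
  [set w : seq S | quasigeodesic c%:R%R (eps%:R : R)%R w]%classic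
  (ex_intro _ gram eq_gram) (fun u v uv qv z zu => qv z (infix_trans zu uv)).
have [al [be [/lift_word[al' <-] /lift_word[be' <-] qg [k badl] [l badr]]]] := Hp p p_gt0.
pose x' : S := [` xS]%fset.
have mapx q : nseq q x = [seq val s | s <- nseq q x'] by rewrite map_nseq.
case: (pP al' be' x').
- apply/qgE => u /infixP[l1 [l2 eq_w]].
  have := qg (size l1) (size l1 + size u).
  rewrite mapx -!map_cat eq_w size_map !size_cat -!map_take take_size_cat //.
  rewrite catA take_size_cat ?size_cat // map_cat prodw_cat mulKg -word_val_prodw addKn.
  by apply; rewrite ?addnA leq_addr.
- move=> /(_ k)/qgE/(_ _ (infix_refl _)); rewrite word_val_prodw map_cat -mapx.
  by rewrite leqNgt => /negP; apply; move: badl; rewrite !size_cat size_map !size_nseq.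
- move=> /(_ l)/qgE/(_ _ (infix_refl _)); rewrite word_val_prodw map_cat -mapx.
  by rewrite leqNgt => /negP; apply; move: badr; rewrite !size_cat size_map !size_nseq.
Qed.

End Words.

(** * Affine maps of the rational line *)

Local Open Scope ring_scope.

(* The pair [(h, z)] stands for the affine map [x |-> q ^ h * x + z]; keeping the
   exponent [h] makes the group useful also when [q] is a root of unity. *)
Definition aff (q : rat) (q0 : q != 0) : Type := (int * rat)%type.

Section Affine.
Variables (q : rat) (q0 : q != 0).
Implicit Types x y : aff q0.

HB.instance Definition _ := Choice.on (aff q0).

Definition aff_mul x y : aff q0 := (x.1 + y.1, x.2 + q ^ x.1 * y.2).
Definition aff_inv x : aff q0 := (- x.1, - (q ^ (- x.1) * x.2)).

Lemma aff_mulA : associative aff_mul.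
Proof.
move=> x y z; rewrite /aff_mul /= addrA expfzDr //; congr (_, _); ring.
Qed.

Lemma aff_mul1 : left_id ((0, 0) : aff q0) aff_mul.
Proof. by case=> h z; rewrite /aff_mul /= expr0z !add0r mul1r. Qed.

Lemma aff_mulV : left_inverse ((0, 0) : aff q0) aff_inv aff_mul.
Proof. by case=> h z; rewrite /aff_mul /= !addNr. Qed.

Lemma aff_invK : involutive aff_inv.
Proof.
case=> h z; rewrite /aff_inv /= !opprK; congr (_, _).
by rewrite mulrN opprK mulrA -expfzDr // addrN expr0z mul1r.
Qed.

Lemma aff_invM : {morph aff_inv : x y / aff_mul x y >-> aff_mul y x}.
Proof.
case=> h z [k y]; rewrite /aff_inv /aff_mul /= opprD expfzDr // [- h - k]addrC.
congr (_, _); have : q ^ (- h) * q ^ h = 1 by rewrite -expfzDr // addNr expr0z.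
by move: (q ^ _) (q ^ _) (q ^ _) => u v w vw; ring: vw.
Qed.

HB.instance Definition _ := isStarMonoid.Build (aff q0)
  aff_mulA aff_mul1 aff_invK aff_invM.
HB.instance Definition _ := StarMonoid_isGroup.Build (aff q0) aff_mulV.

Lemma aff_mulE x y : (x * y)%g = (x.1 + y.1, x.2 + q ^ x.1 * y.2).
Proof. by []. Qed.

Lemma aff_invE x : (x^-1)%g = (- x.1, - (q ^ (- x.1) * x.2)).
Proof. by []. Qed.

Lemma aff_divE x y : (x^-1 * y)%g = (y.1 - x.1, q ^ (- x.1) * (y.2 - x.2)).
Proof. by rewrite aff_mulE aff_invE /= addrC; congr (_, _); ring. Qed.

Lemma aff_expg0 z k : (((0, z) : aff q0) ^+ k)%g = (0, z *+ k).
Proof.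
elim: k => [|k IH]; first by rewrite expg0.
by rewrite expgS IH aff_mulE /= expr0z mul1r addr0 -mulrS.
Qed.

Lemma aff_expgX h k : (((h, 0) : aff q0) ^+ k)%g = (h *+ k, 0).
Proof.
elim: k => [|k IH]; first by rewrite expg0.
by rewrite expgS IH aff_mulE /= mulr0 addr0 -mulrS.
Qed.

End Affine.

(** * The undistorted case *)

Section Morphism.
Variables (G H : groupType) (phi : G -> H).
Hypothesis phiM : forall x y, phi (x * y)%g = (phi x * phi y)%g.

Lemma morph_one : phi 1%g = 1%g.
Proof. by apply: (@mulgI _ (phi 1%g)); rewrite -phiM !mulg1. Qed.

Lemma morph_inv x : phi (x^-1)%g = ((phi x)^-1)%g.
Proof. by apply: (@mulgI _ (phi x)); rewrite -phiM !mulgV morph_one. Qed.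

Lemma morph_exp x k : phi (x ^+ k)%g = (phi x ^+ k)%g.
Proof. by elim: k => [|k IH]; rewrite ?expg0 ?morph_one // !expgS phiM IH. Qed.

(** Source of the lower bounds on word length: a growth estimate for images under [phi] is
    propagated along a shortest word. *)
Lemma word_length_morph (S : {fset G}) (P : nat -> H -> Prop) :
  symmetric_generating S -> P 0%N 1%g ->
  (forall k s x, s \in S -> P k x -> P k.+1 (phi s * x)%g) ->
  forall g, P (word_length S g) (phi g).
Proof.
move=> symS P1 PM g; have [w [wS <- <-]] := word_lengthP symS g.
elim: w wS => [|s w IH] /=; first by rewrite /prodw big_nil morph_one.
by case/andP=> sS /IH Pw; rewrite prodw_cons phiM; apply: PM.
Qed.

End Morphism.

Section Paths.
Variable G : groupType.
Implicit Types w : seq G.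

Lemma prodw_take_cat w1 w2 i : (i <= size (w1 ++ w2))%N ->
  ((i <= size w1)%N /\ prodw (take i (w1 ++ w2)) = prodw (take i w1)) \/
  exists2 j, i = (size w1 + j)%N &
    (j <= size w2)%N /\ prodw (take i (w1 ++ w2)) = (prodw w1 * prodw (take j w2))%g.
Proof.
rewrite size_cat take_cat => le_i; case: ltnP => [lt|ge].
  by left; split=> //; apply: ltnW.
right; exists (i - size w1)%N; first by lia.
by split; [lia|rewrite prodw_cat].
Qed.

Lemma prodw_take_nseq (g : G) k i : (i <= k)%N -> prodw (take i (nseq k g)) = (g ^+ i)%g.
Proof. by move=> le_ik; rewrite take_nseq // prodw_nseq. Qed.

End Paths.

Definition generated_by (G : groupType) (a t : G) :=
  forall g, exists w : seq (bool * bool),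
    g = (\prod_(p <- w) letter_val (fun x : bool => if x then t else a) p)%g.

Lemma generated_sym (G : groupType) (a t : G) (S : {fset G}) : generated_by a t ->
  a \in S -> t \in S -> (forall s, s \in S -> (s^-1)%g \in S) -> symmetric_generating S.
Proof.
move=> gen aS tS SV; split=> // g; have [w ->] := gen g.
have [|w' eq_w'] := @lift_word _ S
    [seq letter_val (fun x : bool => if x then t else a) p | p <- w].
  apply/allP => _ /mapP[[x b] _ ->]; rewrite /letter_val /=.
  by case: x; case: b => //=; apply: SV.
by exists w'; rewrite word_val_prodw eq_w' /prodw big_map.
Qed.

Section Undistorted.
Variables (G : groupType) (a t : G) (N : nat) (q : rat) (q0 : q != 0) (phi : G -> aff q0).
Hypotheses (gen : generated_by a t) (N_gt0 : (0 < N)%N).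
Hypothesis comm : commute (t ^+ 2)%g (a ^+ N)%g.
Hypothesis phiM : forall x y, phi (x * y)%g = (phi x * phi y)%g.
Hypotheses (phi_a : phi a = (0, 1)) (phi_t : phi t = (1, 0)) (q2 : q ^+ 2 = 1).

Let S : {fset G} := [fset a; (a^-1)%g; t; (t^-1)%g]%fset.

Let symS : symmetric_generating S.
Proof.
apply: generated_sym gen _ _ _; rewrite ?inE ?eqxx ?orbT //.
by move=> s; rewrite !inE => /orP[/orP[/orP[]|]|] /eqP->; rewrite ?invgK eqxx ?orbT.
Qed.

Let normq (h : int) : `|q ^ h| = 1.
Proof.
have /eqP : `|q| ^+ 2 = 1 by rewrite -normrX q2 normr1.
rewrite sqrp_eq1 // => /eqP q1.
by case: h => k; rewrite /exprz ?normfV normrX q1 expr1n ?invr1.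
Qed.

Let bound (k : nat) (x : aff q0) := `|x.1| <= k%:Z /\ `|x.2| <= k%:R.

(** As [|q| = 1], each generator changes height and translation by at most 1. *)
Let word_length_bound g : bound (word_length S g) (phi g).
Proof.
apply: word_length_morph g => // k s x sS [le1 le2].
have [n1 n2] : bound 1 (phi s).
  rewrite /bound; move: sS; rewrite !inE.
  move=> /orP[/orP[/orP[]|]|] /eqP->;
  rewrite ?(morph_inv phiM) ?phi_a ?phi_t ?aff_invE /=;
  by rewrite ?mulr0 ?mulr1 ?oppr0 ?normrN ?normq ?normr0 ?normr1.
rewrite /bound aff_mulE /=; split; first lia.
by rewrite -natr1 addrC (le_trans (ler_normD _ _)) // normrM normq mul1r lerD.
Qed.

Lemma undistorted_not_QCF (R : realType) : ~ QCF R G.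
Proof.
have phi_exp g k : phi (g ^+ k)%g = (phi g ^+ k)%g := morph_exp phiM g k.
apply: (@not_QCF_block G S symS R 4 0 a) => // [|p _]; first by rewrite !inE eqxx.
(* An even [j] gives both [q ^+ j = 1] and the commutation. *)
have [j [le_pj qj tj]] : exists j : nat,
    [/\ (2 * p < j)%N, q ^+ j = 1 & commute (t ^+ j)%g (a ^+ N)%g].
  exists (2 * p.+1)%N; rewrite ltn_pmul2l //; split=> //.
    by rewrite exprM q2 expr1n.
  by rewrite expgnA; apply/commute_sym/commuteX/commute_sym.
(* A multiple of [N], so that [a ^+ l] commutes with [t ^+ j]. *)
pose l := (N * (2 * j))%N.
have tj_al : commute (t ^+ j)%g (a ^+ l)%g by rewrite /l expgnA; apply: commuteX.
have wl_tj : (word_length S (t ^+ j)%g <= j)%N.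
  rewrite -prodw_nseq (leq_trans (word_length_le _)) ?size_nseq //.
  by rewrite all_nseq /= !inE eqxx ?orbT.
have le_l : (2 * j <= l)%N by rewrite leq_pmull.
exists (nseq l a^-1%g ++ nseq j t), (nseq j t ++ nseq l a^-1%g).
rewrite !all_cat !all_nseq /= !inE !eqxx !orbT; split=> //.
- rewrite -catA; set w := _ ++ _.
  (* Height and translation along the five runs [a^-l], [t^j], [a^p], [t^j], [a^-l]. *)
  have pt i : (i <= size w)%N -> exists h z : int, phi (prodw (take i w)) = (h, z%:~R) /\
      ((exists x : nat, [/\ (x <= l)%N, i = (x)%N, h = 0 & z = - x%:Z])  \/
       (exists x : nat, [/\ (x <= j)%N, i = (l + x)%N, h = x%:Z & z = - l%:Z])  \/
       (exists x : nat, [/\ (x <= p)%N, i = (l + j + x)%N, h = j%:Z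
                          & z = x%:Z - l%:Z]) \/
       (exists x : nat, [/\ (x <= j)%N, i = (l + j + p + x)%N, h = j%:Z + x%:Z
                          & z = p%:Z - l%:Z]) \/
       (exists x : nat, [/\ (x <= l)%N, i = (l + j + p + j + x)%N, h = j%:Z + j%:Z
                          & z = p%:Z - l%:Z - x%:Z]) ).
    have phi_aV : phi (a^-1)%g = (0, -1).
      by rewrite morph_inv // phi_a aff_invE /= mulr1 oppr0 expr0z.
    move=> /prodw_take_cat[].
      rewrite size_nseq => -[le_i ->]; exists 0, (- i%:Z); split.
        by rewrite prodw_take_nseq // phi_exp phi_aV aff_expg0 mulNrn mulrNz.
      by left; exists i.
    rewrite size_nseq => -[{}i -> [le_i ->]]; move: le_i => /prodw_take_cat[].
      rewrite size_nseq => -[le_i ->]; exists i%:Z, (- l%:Z); split.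
        rewrite prodw_take_nseq // prodw_nseq phiM !phi_exp phi_aV phi_t.
        rewrite aff_expg0 aff_expgX.
        by rewrite aff_mulE /= expr0z; congr (_, _); rewrite ?add0r ?natz //; ring.
      by right; left; exists i.
    rewrite size_nseq => -[{}i -> [le_i ->]]; move: le_i => /prodw_take_cat[].
      rewrite size_nseq => -[le_i ->]; exists j%:Z, (i%:Z - l%:Z); split.
        rewrite prodw_take_nseq // !prodw_nseq !phiM !phi_exp phi_aV phi_t phi_a.
        rewrite !aff_expg0 !aff_expgX !aff_mulE /= expr0z !natz -exprnP qj.
        rewrite rmorphB /= !pmulrn.
        by congr (_, _); ring.
      by do 2!right; left; exists i; split=> //; rewrite addnA.
    rewrite size_nseq => -[{}i -> [le_i ->]]; move: le_i => /prodw_take_cat[].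
      rewrite size_nseq => -[le_i ->]; exists (j%:Z + i%:Z), (p%:Z - l%:Z); split.
        rewrite prodw_take_nseq // !prodw_nseq !phiM !phi_exp phi_aV phi_t phi_a.
        rewrite !aff_expg0 !aff_expgX !aff_mulE /= expr0z !natz -exprnP qj.
        rewrite rmorphB /= !pmulrn.
        by congr (_, _); ring.
      by do 3!right; left; exists i; split=> //; rewrite !addnA.
    rewrite !size_nseq => -[{}i -> [le_i ->]].
    exists (j%:Z + j%:Z), (p%:Z - l%:Z - i%:Z); split.
      rewrite prodw_take_nseq // !prodw_nseq !phiM !phi_exp phi_aV phi_t phi_a.
      rewrite !aff_expg0 !aff_expgX !aff_mulE /= expr0z !natz -!exprnP ?exprD ?qj.
      rewrite !rmorphB /= !pmulrn.
      by congr (_, _); ring.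
    by do 4!right; exists i; split=> //; rewrite !addnA.
  move=> i1 i2 le_i12 le_i2.
  have [h1 [z1 [eq1 k1]]] := pt i1 (leq_trans le_i12 le_i2).
  have [h2 [z2 [eq2 k2]]] := pt i2 le_i2.
  have := word_length_bound ((prodw (take i1 w))^-1 * prodw (take i2 w))%g.
  rewrite phiM (morph_inv phiM) eq1 eq2 aff_divE /bound /= normrM normq mul1r.
  rewrite -intrB -intr_norm pmulrn ler_int.
  move: (word_length _ _) => k [] {eq1 eq2}.
  (* Only the run [a^p] moves against the outer runs. This hides at most [2 * p < j] letters, while
     a run [t^j] in between adds [j] to the height. *)
  by case: k1 => [|[|[|[|]]]] [x [? ? ? ?]]; case: k2 => [|[|[|[|]]]] [y [? ? ? ?]]; lia.
(* [a^-l t^j a^l = t^j], of word length at most [j], whereas the word has length [2 * l + j]. *)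
- exists l; rewrite !prodw_cat !prodw_nseq expVgn -mulgA.
  by rewrite tj_al mulKg !size_cat !size_nseq; lia.
- exists l; rewrite !prodw_cat !prodw_nseq expVgn mulgA -tj_al mulgK.
  by rewrite !size_cat !size_nseq; lia.
Qed.

End Undistorted.

(** * Rationals integral at the numerator of [q] *)

Section Localization.
Variable q : rat.
Hypothesis q_gt1 : 1 < `|q|.

Definition nu : rat := (numq q)%:~R.

(** The subring of fractions whose denominator can be chosen coprime to the numerator of [q]. *)
Definition nu_integral (x : rat) : Prop :=
  exists d c : int, coprimez (numq q) d /\ d%:~R * x = c%:~R.

Lemma norm_gt1_neq0 : q != 0.
Proof. by rewrite -normr_gt0 (lt_trans ltr01). Qed.

Lemma nu_neq0 : nu != 0.
Proof. by rewrite intr_eq0 numq_eq0 norm_gt1_neq0. Qed.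

Lemma mul_q_denq : q * (denq q)%:~R = nu.
Proof. by rewrite -[X in X * _]divq_num_den divfK ?intr_eq0 ?denq_neq0. Qed.

Lemma nu_integral_int (c : int) : nu_integral c%:~R.
Proof. by exists 1, c; rewrite /coprimez gcdz1 mul1r. Qed.

Lemma nu_integralD x y : nu_integral x -> nu_integral y -> nu_integral (x + y).
Proof.
move=> [d [c [cd eq_c]]] [d' [c' [cd' eq_c']]].
exists (d * d'), (d' * c + d * c'); rewrite coprimezMr cd cd'; split=> //.
by rewrite rmorphD !rmorphM /= -eq_c -eq_c'; ring.
Qed.

Lemma nu_integralM x y : nu_integral x -> nu_integral y -> nu_integral (x * y).
Proof.
move=> [d [c [cd eq_c]]] [d' [c' [cd' eq_c']]].
exists (d * d'), (c * c'); rewrite coprimezMr cd cd'; split=> //.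
by rewrite !rmorphM /= -eq_c -eq_c'; ring.
Qed.

Lemma nu_integralN x : nu_integral x -> nu_integral (- x).
Proof. by move=> /(nu_integralM (nu_integral_int (-1))); rewrite mulN1r. Qed.

Lemma nu_integralX x k : nu_integral x -> nu_integral (x ^+ k).
Proof.
move=> int_x; elim: k => [|k IH]; first exact: (nu_integral_int 1).
by rewrite exprS; apply: nu_integralM.
Qed.

Lemma nu_integral_q_nu : nu_integral (q / nu).
Proof.
exists (denq q), 1; split; first by rewrite /coprimez; exact: coprime_num_den.
by rewrite mulrCA mulrA mul_q_denq divff ?nu_neq0.
Qed.

Lemma nu_integral_q : nu_integral q.
Proof.
rewrite -[q](divfK nu_neq0); apply: nu_integralM nu_integral_q_nu _.
exact: nu_integral_int.
Qed.

Lemma nu_div_q : nu / q = (denq q)%:~R.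
Proof.
by rewrite -mul_q_denq mulrAC divff ?norm_gt1_neq0 ?mul1r.
Qed.

(** Otherwise the numerator of [q] divides an integer coprime to it, so it is a unit, against
    [|q| > 1]. *)
Lemma nu_inv_not_integral : ~ nu_integral nu^-1.
Proof.
move=> [d [c [cop eq_c]]]; have n0 := nu_neq0.
have eq_d : d = c * numq q.
  by apply/eqP; rewrite -(eqr_int rat) rmorphM /= -eq_c mulfVK.
move: cop; rewrite eq_d coprimezMr /coprimez gcdzz => /andP[_ /eqP eq1].
have := divq_num_den q => eq_q; move: q_gt1.
rewrite -eq_q normrM normfV -!intr_norm -abszE eq1.
have : 1 <= (denq q)%:~R :> rat by rewrite ler1z -gtz0_ge1 denq_gt0.
rewrite gtr0_norm ?denq_gt0 // div1r => le1 lt1.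
by have := invf_le1 (lt_le_trans ltr01 le1); rewrite le1 leNgt lt1.
Qed.

(* Among the elements [c + nu * y] with [c = 1] or [c = -1], dividing by [q] once
   more than multiplying by [nu] leaves a pole at [nu]. *)
Lemma nu_pole k r h (c : int) y : `|c| = 1 -> nu_integral y ->
  nu_integral (nu ^+ k * (q ^ (- h%:Z) * (q ^+ r * (c%:~R + nu * y)))) -> (h <= r + k)%N.
Proof.
move=> c1 int_y int_T; rewrite leqNgt; apply/negP => lt_h.
have [s eq_h] : exists s, h = (r + k.+1 + s)%N by exists (h - (r + k.+1))%N; lia.
apply: nu_inv_not_integral.
(* Multiplying by the integral number [(q / nu) ^+ k.+1 * q ^+ s] leaves [c / nu + y]. *)
have := nu_integralM (nu_integralX k.+1 nu_integral_q_nu)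
  (nu_integralM (nu_integralX s nu_integral_q) int_T).
have n0 := nu_neq0; have q0 := norm_gt1_neq0.
have -> : (q / nu) ^+ k.+1 * (q ^+ s *
    (nu ^+ k * (q ^ (- h%:Z) * (q ^+ r * (c%:~R + nu * y))))) = nu^-1 * c%:~R + y.
  rewrite eq_h -exprnN !exprD expr_div_n !exprS.
  have qX j : q ^+ j != 0 by rewrite expf_neq0.
  have nX j : nu ^+ j != 0 by rewrite expf_neq0.
  by field; rewrite n0 q0 !qX nX.
move=> /nu_integralD/(_ (nu_integralN int_y)); rewrite addrK.
move/nu_integralM/(_ (nu_integral_int c)); rewrite -mulrA -rmorphM /=.
have -> : c * c = 1 by move: c1; case: (ger0P c) => _; lia.
by rewrite mulr1.
Qed.

End Localization.

(** * The path of the test word in the affine group *)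

Section Points.
Variables (q : rat) (q_gt1 : 1 < `|q|) (Z : nat -> rat) (K : rat) (e : nat).
Hypotheses (Z0 : Z 0 = 0) (Z_ge : forall j, (0 < j)%N -> `|q| ^+ j <= `|Z j|).
Hypothesis Z_le : forall j, `|Z j| <= K * `|q| ^+ j.
Hypothesis Z_nu : forall j, exists2 y, nu_integral q y & Z j = nu q * y.
Hypotheses (e1 : `|q| <= `|q| ^+ e * (`|q| - 1)) (e2 : 2 * (K + 1) <= `|q| ^+ e).

(** The translation of [t^i down j], where [Z j] is the signed exponent of [a] in [t^j down j]. *)
Let offset i j := q ^+ (i - j) * Z j.

(* What word length [k] implies for an element that leads from a point of height
   [h1] to a point of height [h2], when the translation parts of these points
   differ by [D]: the heights are close, [D] is not too large, and neither point lies
   much above the height [r] at which [D] is a unit at [nu q]. *)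
Definition near k h1 h2 (D : rat) := [/\ (h1 <= h2 + k)%N, (h2 <= h1 + k)%N,
  forall r, `|q| ^+ r <= `|q| ^+ e * `|D| ->
    (r <= e + h1 + e * k)%N /\ (r <= e + h2 + e * k)%N
& forall r (c : int) y, `|c| = 1 -> nu_integral q y ->
    D = q ^+ r * (c%:~R + nu q * y) -> (h1 <= r + k)%N /\ (h2 <= r + k)%N].

(* The prefix of length [s] of [t^i down i a (down i)^-1] acts as
   [x |-> q ^ h * x + T]. *)
Variant alpha_point i s h (T : rat) : Prop :=
| AlphaUp of (s <= i)%N & h = s & T = 0
| AlphaDown j of (j <= i)%N & s = (i + j)%N & (h + j = i)%N & T = offset i j
| AlphaBack j of (j <= i)%N & (s + j = 3 * i + 1)%N & (h + j = i)%N & T = 1 + offset i j.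

(* The same for the word [al t^-p a^-1 al], with [al] as above. *)
Variant path_point i p s h (T : rat) : Prop :=
| PathAlpha of alpha_point i s h T
| PathBlock j of (j <= p)%N & s = (3 * i + 1 + j)%N & (h + j = i)%N & T = 1
| PathBeta s' h' T' of alpha_point i s' h' T' & s = (3 * i + p + 2 + s')%N
    & h = (i - p + h')%N & T = 1 - q ^+ (i - p) + q ^+ (i - p) * T'.

Let Q := `|q|.
Let Q_gt0 : 0 < Q. Proof. exact: lt_trans ltr01 q_gt1. Qed.
Let Q_ge1 : 1 <= Q. Proof. exact: ltW q_gt1. Qed.

Lemma offset0 i : offset i 0 = 0. Proof. by rewrite /offset Z0 mulr0. Qed.

Lemma offset_ge i j : (0 < j <= i)%N -> Q ^+ i <= `|offset i j|.
Proof.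
move=> /andP[j_gt0 le_ji]; rewrite /offset normrM normrX -{1}(subnK le_ji) exprD.
by rewrite ler_wpM2l ?exprn_ge0 ?normr_ge0 ?Z_ge.
Qed.

Lemma offset_le i j : (j <= i)%N -> `|offset i j| <= K * Q ^+ i.
Proof.
move=> le_ji; rewrite /offset normrM normrX -{2}(subnK le_ji) exprD mulrCA.
by rewrite ler_wpM2l ?exprn_ge0 ?normr_ge0 ?Z_le.
Qed.

Lemma offset_nu i j : exists2 y, nu_integral q y & offset i j = nu q * y.
Proof.
have [y int_y eq_Z] := Z_nu j; exists (q ^+ (i - j) * y); last first.
  by rewrite /offset eq_Z mulrCA.
exact/nu_integralM/int_y/nu_integralX/nu_integral_q.
Qed.

Lemma offset_shift i p j : (j <= p <= i)%N -> offset i j = q ^+ (i - p) * offset p j.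
Proof.
by move=> le_jpi; rewrite /offset mulrA -exprD; congr (q ^+ _ * _); lia.
Qed.

(** The offset is at least [|q|^i], so [T] cannot cancel it; [e1] absorbs the loss. *)
Lemma offset_far i j (T : rat) : (0 < j <= i)%N -> `|T| <= Q ^+ i.-1 ->
  Q ^+ i <= Q ^+ e * `|offset i j + T|.
Proof.
case: i => [|i] ji /= le_T; first by case: j ji.
have le1 : Q ^+ i.+1 - Q ^+ i <= `|offset i.+1 j + T|.
  have := ler_normB (offset i.+1 j + T) T; rewrite addrK.
  by have := offset_ge ji; lra.
apply: le_trans (ler_wpM2l (exprn_ge0 e (ltW Q_gt0)) le1).
rewrite exprS -[X in _ - X]mul1r -mulrBl mulrA.
by rewrite ler_wpM2r // exprn_ge0 // ltW.
Qed.

(** Left multiplication by an element of height [c] preserves quotients; it adds [c] to heights and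
    scales [D] by [q ^+ c]. *)
Lemma near_shift k c h1 h2 D : near k (c + h1) (c + h2) (q ^+ c * D) -> near k h1 h2 D.
Proof.
case=> le1 le2 arch padic; split; [lia|lia| |].
  move=> r le_r; have [] := arch (c + r)%N; last by lia.
  by rewrite normrM normrX mulrCA exprD ler_wpM2l // exprn_ge0.
move=> r d y d1 int_y eq_D; have [] := padic (c + r)%N d y d1 int_y; last by lia.
by rewrite eq_D exprD mulrA.
Qed.

(** Within one leg the height determines the position. Between two legs, the size of [D] forces the
    heights close to [i], or [D] is a unit at [nu] and forces them close to 0. *)
Lemma alpha_near i s1 s2 h1 h2 T1 T2 k : (s1 <= s2)%N ->
  alpha_point i s1 h1 T1 -> alpha_point i s2 h2 T2 -> near k h1 h2 (T2 - T1) ->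
  (s2 - s1 <= 3 * (e + k + e * k) + 1)%N.
Proof.
move=> le_s.
case=> [s1i eq_h1 ->|j1 j1i eq_s1 eq_h1 ->|j1 j1i eq_s1 eq_h1 ->];
case=> [s2i eq_h2 ->|j2 j2i eq_s2 eq_h2 ->|j2 j2i eq_s2 eq_h2 ->];
case=> le1 le2 arch padic; try lia.
- have [j0|j_gt0] := posnP j2; first by lia.
  have [|] := arch i; last by lia.
  rewrite subr0 -[offset i j2]addr0; apply: offset_far; first by rewrite j_gt0.
  by rewrite normr0 exprn_ge0 ?normr_ge0.
(* Here [D] is a unit at [nu], so the heights are at most [k]. As moreover [D] is large or [h2 = i],
   this bounds [i]. *)
- have [y int_y eq_y] := offset_nu i j2.
  have [|p1 p2] := padic 0%N 1 y (normr1 _) int_y.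
    by rewrite expr0 mul1r subr0 eq_y.
  have [j0|j_gt0] := posnP j2; first by lia.
  have [|] := arch i; last by lia.
  rewrite subr0 addrC; apply: offset_far; first by rewrite j_gt0.
  by rewrite normr1 exprn_ege1.
- have [y1 int_y1 eq_y1] := offset_nu i j1; have [y2 int_y2 eq_y2] := offset_nu i j2.
  have [] := padic 0%N 1 (y2 - y1) (normr1 _).
  + exact/nu_integralD/nu_integralN.
  + by rewrite expr0 mul1r eq_y1 eq_y2; ring.
  by lia.
Qed.

(** The second [alpha] starts at height [i - p], which scales its translations by [q ^+ (i - p)]. By
    [e2] they outweigh any [Y] from the first one. *)
Lemma beta_far i p Y T : (p + e <= i)%N -> `|Y| <= K * Q ^+ i ->
  Q ^+ i - 1 <= `|T - 1| -> Q ^+ (i - p + i) <= Q ^+ e * `|q ^+ (i - p) * (T - 1) - Y|.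
Proof.
move=> le_i le_Y le_T; set r := (i - p)%N.
have Qr : 2 * (K + 1) <= Q ^+ r by rewrite (le_trans e2) // ler_weXn2l //; lia.
have Qri : Q ^+ r <= Q ^+ i by rewrite ler_weXn2l // leq_subr.
have Qi0 : 0 <= Q ^+ i by rewrite exprn_ge0 // ltW.
have le1 : Q ^+ r * (Q ^+ i - 1) - K * Q ^+ i <= `|q ^+ r * (T - 1) - Y|.
  have := ler_normD (q ^+ r * (T - 1) - Y) Y; rewrite subrK normrM normrX -/Q.
  have := ler_wpM2l (exprn_ge0 r (ltW Q_gt0)) le_T.
  by move: (Q ^+ r * _) le_Y => ?; lra.
have Qe2 : 2 <= Q ^+ e.
  have : 0 <= K by have := Z_le 0; rewrite Z0 normr0 expr0 mulr1.
  by move: e2; rewrite -/Q; lra.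
have le2 : Q ^+ (r + i) <= 2 * (Q ^+ r * (Q ^+ i - 1) - K * Q ^+ i) by rewrite exprD; nra.
have ge0 : 0 <= Q ^+ r * (Q ^+ i - 1) - K * Q ^+ i.
  by rewrite -(@pmulr_rge0 _ 2) // (le_trans _ le2) // exprn_ge0 // ltW.
by apply: le_trans le2 _; apply: ler_pM.
Qed.

(* A point after the middle letter of the first [alpha] and a point of the second
   one are far apart, unless the latter lies on the initial ascent. *)
Lemma late_near i p s h1 h2 h T Y k : (2 * p <= i)%N -> (p + e <= i)%N ->
  `|Y| <= K * Q ^+ i -> (h1 <= i)%N -> alpha_point i s h T -> h2 = (i - p + h)%N ->
  near k h1 h2 (q ^+ (i - p) * (T - 1) - Y) ->
  (T = 0 /\ s = h) \/ (7 * i + 3 <= 20 * (e * k + k + e + 1))%N.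
Proof.
move=> le_pi le_ei le_Y le_h1 al eq_h2 [le1 le2 arch _].
have far : Q ^+ i - 1 <= `|T - 1| ->
    (7 * i + 3 <= 20 * (e * k + k + e + 1))%N.
  (* From [i - p + i <= e + h1 + e * k], [h1 <= i] and [2 * p <= i] one bounds [i]; the whole word
     has length at most [7 * i + 3]. *)
  by move=> /(beta_far le_ei le_Y)/arch[]; lia.
case: al => [si eq_h eq_T|j ji eq_s eq_h eq_T|j ji eq_s eq_h eq_T].
- by left.
- have [j0|j_gt0] := posnP j; first by left; rewrite eq_T j0 offset0; split=> //; lia.
  right; apply: far; have := @offset_ge i j; rewrite j_gt0 => /(_ ji).
  by have := ler_normB (T - 1) (- 1); rewrite opprK subrK normrN normr1 eq_T; lra.
- have [j0|j_gt0] := posnP j; first by right; lia.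
  right; apply: far; have := @offset_ge i j; rewrite j_gt0 => /(_ ji).
  by rewrite eq_T [1 + _]addrC addrK; lra.
Qed.

Lemma path_near i p s1 s2 h1 h2 T1 T2 k : (0 < p)%N -> (2 * p <= i)%N -> (p + e <= i)%N ->
  (s1 <= s2)%N -> path_point i p s1 h1 T1 -> path_point i p s2 h2 T2 ->
  near k h1 h2 (T2 - T1) -> (s2 - s1 <= 20 * (e * k + k + e + 1))%N.
Proof.
move=> p_gt0 le_pi le_ei le_s pt1 pt2.
(* The first point lies on the ascent or descent of [alpha], before its middle
   letter [a]; the second one lies after it. *)
have early y1 y2 : nu_integral q y1 -> nu_integral q y2 ->
    T1 = nu q * y1 -> T2 = 1 + nu q * y2 -> (i - p <= h2)%N -> (s2 <= 7 * i + 3)%N ->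
    near k h1 h2 (T2 - T1) -> (s2 - s1 <= 20 * (e * k + k + e + 1))%N.
  move=> int_y1 int_y2 -> -> le_h2 le_s2 [_ _ _ padic].
  (* [D] is a unit at [nu], so [i - p <= h2 <= k], which bounds [i]. *)
  have [] := padic 0%N 1 (y2 - y1) (normr1 _).
  - exact/nu_integralD/nu_integralN.
  - by rewrite expr0 mul1r; ring.
  by lia.
case: pt1 => [al1|j1 j1p eq_s1 eq_h1 eq_T1|s1' h1' T1' al1 eq_s1 eq_h1 eq_T1];
case: pt2 => [al2|j2 j2p eq_s2 eq_h2 eq_T2|s2' h2' T2' al2 eq_s2 eq_h2 eq_T2].
- by move=> /(alpha_near le_s al1 al2); lia.
- case: al1 => [s1i eq_h1 eq_T1|j1 j1i eq_s1 eq_h1 eq_T1|j1 j1i eq_s1 eq_h1 eq_T1].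
  + apply: (early 0 0); rewrite ?mulr0 ?addr0 //; try exact: (nu_integral_int _ 0); lia.
  + have [y int_y eq_y] := offset_nu i j1.
    apply: (early y 0); rewrite ?mulr0 ?addr0 -?eq_y //;
      try exact: (nu_integral_int _ 0); lia.
  + case=> le1 le2 arch _; have [j0|j_gt0] := posnP j1; first by lia.
    have [|] := arch i; last by lia.
    have -> : T2 - T1 = - (offset i j1 + 0) by rewrite eq_T1 eq_T2; ring.
    rewrite normrN; apply: offset_far; first by rewrite j_gt0.
    by rewrite normr0 exprn_ge0 ?normr_ge0.
- have le_s2 : (s2 <= s2' + (3 * i + p + 2))%N by lia.
  have le_s2' : (s2' <= 3 * i + 1)%N by case: al2; lia.
  have r_gt0 : (i - p = (i - p).-1.+1)%N by lia.
  have [y2 int_y2 eq_y2] : exists2 y, nu_integral q y & T2' = y.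
    exists T2' => //; case: al2 => [_ _ ->|j _ _ _ ->|j _ _ _ ->].
    + exact: (nu_integral_int _ 0).
    + have [y ? ->] := offset_nu i j.
      by apply: nu_integralM => //; apply: nu_integral_int.
    + have [y ? ->] := offset_nu i j.
      apply: nu_integralD; first exact: (nu_integral_int _ 1).
      by apply: nu_integralM => //; apply: nu_integral_int.
  (* As [i - p > 0], the translation is still 1 modulo [nu], so [early] applies before the middle
     letter of the first [alpha]. *)
  have earlyT2 : exists2 y, nu_integral q y & T2 = 1 + nu q * y.
    exists (q / nu q * q ^+ (i - p).-1 * (y2 - 1)).
      apply: nu_integralM; first apply: nu_integralM.
      + exact: nu_integral_q_nu.
      + exact/nu_integralX/nu_integral_q.
      + by apply: nu_integralD => //; apply: (nu_integral_int _ (-1)).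
    by rewrite eq_T2 eq_y2 r_gt0 exprS /=; have := nu_neq0 q_gt1 => n0; field.
  have [y int_y eq_y] := earlyT2.
  case: al1 => [s1i eq_h1 eq_T1|j1 j1i eq_s1 eq_h1 eq_T1|j1 j1i eq_s1 eq_h1 eq_T1].
  + by apply: (early 0 y); rewrite ?mulr0 //; try exact: (nu_integral_int _ 0); lia.
  + have [y1 int_y1 eq_y1] := offset_nu i j1.
    by apply: (early y1 y); rewrite -?eq_y1 //; lia.
  have eq_D : T2 - T1 = q ^+ (i - p) * (T2' - 1) - offset i j1.
    by rewrite eq_T1 eq_T2; ring.
  rewrite eq_D => near12.
  have [|[eq_T2' eq_s2']|] :=
    late_near le_pi le_ei (offset_le j1i) _ al2 eq_h2 near12.
  + by lia.
  (* From the return of the first [alpha] to the ascent of the second: the size of [D] makes [j1]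
     small. *)
  + case: near12 => le1 le2 arch padic.
    have le_j1 : (0 < j1)%N -> (j1 <= e + e * k)%N.
      move=> j1_gt0; have [|] := arch i; last by lia.
      have -> : q ^+ (i - p) * (T2' - 1) - offset i j1 = - (offset i j1 + q ^+ (i - p)).
        by rewrite eq_T2'; ring.
      rewrite normrN; apply: offset_far; first by rewrite j1_gt0.
      by rewrite normrX ler_weXn2l //; lia.
    (* If [j1 < p], then [D] is [q ^+ (i - p)] times a unit at [nu], so the heights are at most
       [i - p + k]; otherwise [p] is small too. *)
    have [lt_jp|ge_jp] := ltnP j1 p; last by lia.
    have [y1 int_y1 eq_y1] := offset_nu p j1.
    have [|] := padic (i - p)%N (- 1) (- y1) (normrN1 _) (nu_integralN int_y1);
      last by lia.
    rewrite eq_T2' (@offset_shift i p j1) ?eq_y1; [by ring|by lia].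
  by lia.
- case: al2; lia.
- by case=> le1 le2 _ _; lia.
- have le_s2' : (s2' <= 3 * i + 1)%N by case: al2; lia.
  have eq_D : T2 - T1 = q ^+ (i - p) * (T2' - 1) - 0 by rewrite eq_T1 eq_T2; ring.
  rewrite eq_D => near12.
  have [||[eq_T2' eq_s2']|] := late_near le_pi le_ei _ _ al2 eq_h2 near12.
  + by rewrite normr0 -(@normr0 _ rat) -(offset0 i) offset_le.
  + by lia.
  + case: near12 => le1 le2 arch padic.
    have [|] := padic (i - p)%N (- 1) 0 (normrN1 _) (nu_integral_int _ 0); last by lia.
    by rewrite eq_T2'; ring.
  by lia.
- case: al2; lia.
- lia.
- rewrite eq_T1 eq_T2 eq_h1 eq_h2; set c := 1 - _.
  have -> : c + q ^+ (i - p) * T2' - (c + q ^+ (i - p) * T1') =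
      q ^+ (i - p) * (T2' - T1') by ring.
  move/near_shift/(alpha_near _ al1 al2); lia.
Qed.

End Points.

(** * The distorted case *)

Lemma exists_expr_ge (R : archiRealFieldType) (x y : R) : 1 < x -> exists n, y <= x ^+ n.
Proof.
move=> x_gt1; have bern n : 1 + n%:R * (x - 1) <= x ^+ n.
  elim: n => [|n IH]; first by rewrite mul0r addr0 expr0.
  rewrite exprS -natr1.
  have := ler_wpM2l (ltW (lt_trans ltr01 x_gt1)) IH.
  have : 0 <= n%:R * (x - 1) ^+ 2 by rewrite mulr_ge0 // sqr_ge0.
  by rewrite expr2; lra.
have [y_le0|y_gt0] := lerP y 0; first by exists 0%N; rewrite expr0 (le_trans y_le0).
exists (Num.bound (y / (x - 1))); apply: le_trans (bern _).
have : y / (x - 1) < (Num.bound (y / (x - 1)))%:R.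
  by apply: archi_boundP; rewrite divr_ge0 ?subr_ge0 // ltW.
by rewrite ltr_pdivrMr ?subr_gt0 // => lt_y; lra.
Qed.

Section InverseWords.
Variable G : groupType.
Implicit Types w : seq G.

Definition invw w := rev [seq (g^-1)%g | g <- w].

Lemma size_invw w : size (invw w) = size w.
Proof. by rewrite size_rev size_map. Qed.

Lemma prodw_invw w : prodw (invw w) = ((prodw w)^-1)%g.
Proof.
elim: w => [|g w IH]; first by rewrite /prodw !big_nil invg1.
rewrite /invw /= rev_cons -cats1 prodw_cat IH !prodw_cons invgM.
by rewrite /prodw big_nil mulg1.
Qed.

Lemma prodw_take_invw w i : (i <= size w)%N ->
  prodw (take i (invw w)) = ((prodw w)^-1 * prodw (take (size w - i) w))%g.
Proof.
move=> le_i; rewrite /invw take_rev size_map -map_drop -/(invw _) prodw_invw.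
have := prodw_cat (take (size w - i) w) (drop (size w - i) w).
by rewrite cat_take_drop => ->; rewrite invgM mulgVK.
Qed.

Lemma word_length_inv (S : {fset G}) g : symmetric_generating S ->
  word_length S (g^-1)%g = word_length S g.
Proof.
move=> symS; have le h : (word_length S (h^-1)%g <= word_length S h)%N.
  have [w [wS <- <-]] := word_lengthP symS h.
  rewrite -prodw_invw -(size_invw w); apply: word_length_le.
  by rewrite all_rev all_map; apply/allP => x /(allP wS) /= /(symS.1 _).
by apply/eqP; rewrite eqn_leq le; have := le (g^-1)%g; rewrite invgK.
Qed.

End InverseWords.

(** * Digits of the descending words *)

Section Digits.
Variables (M N : nat) (q : rat).
Hypotheses (M_gt0 : (0 < M)%N) (ltMN : (M < N)%N).
Hypothesis normq : `|q| * M%:R = N%:R.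

(* [digit_sum j] is the exponent obtained by pushing all the letters [t^-1] of the
   first [j] digits to the left: the digits are chosen so as to make every
   intermediate exponent a multiple of [M]. *)
Fixpoint digit_sum j : nat := if j is k.+1 then N * (digit_sum k %/ M).+1 else 0.

(** The multiple of [M] is strictly larger than [digit_sum j], so the sums become positive although
    [digit_sum 0 = 0]. *)
Definition digit j := (M * (digit_sum j %/ M).+1 - digit_sum j)%N.

Lemma digitE j : (digit_sum j + digit j = M * (digit_sum j %/ M).+1)%N.
Proof. by rewrite /digit subnKC // mulnC ltnW // ltn_ceil. Qed.

Lemma digit_le j : (digit j <= M)%N.
Proof.
by have := leq_trunc_div (digit_sum j) M; have := digitE j; rewrite mulnS mulnC; lia.
Qed.

Lemma norm_gt1 : 1 < `|q|.
Proof.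
have M0 : 0 < M%:R :> rat by rewrite ltr0n.
by rewrite -(ltr_pM2r M0) normq mul1r ltr_nat.
Qed.

(** Each step rounds up to a multiple of [M] and multiplies by [N / M], which is [|q|]. *)
Lemma digit_sum_ge j : (0 < j)%N -> `|q| ^+ j <= (digit_sum j)%:R.
Proof.
have M0 : 0 < M%:R :> rat by rewrite ltr0n.
have q0 : 0 <= `|q| := normr_ge0 q.
have M1 : 1 <= M%:R :> rat by rewrite ler1n.
case: j => // j _; elim: j => [|j IH].
  by rewrite expr1 /= div0n muln1 -normq ler_peMr.
rewrite exprS; apply: le_trans (ler_wpM2l q0 IH) _.
rewrite -(ler_pM2r M0) [_ * M%:R]mulrAC normq -!natrM ler_nat.
have le : (digit_sum j.+1 <= (digit_sum j.+1 %/ M).+1 * M)%N.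
  by rewrite mulnC -digitE leq_addr.
by rewrite /= -mulnA leq_mul2l; apply/orP; right; exact: le.
Qed.

Lemma digit_sum_le j : (digit_sum j)%:R <= `|q| * M%:R / (`|q| - 1) * `|q| ^+ j.
Proof.
set L := _ / _; have q1 := norm_gt1.
have L0 : 0 <= L by rewrite divr_ge0 ?subr_ge0 ?mulr_ge0 // ltW.
have eqL : L * (`|q| - 1) = `|q| * M%:R by rewrite divfK // subr_eq0 gt_eqF.
have M0 : 0 < M%:R :> rat by rewrite ltr0n.
suff : (digit_sum j)%:R + L <= L * `|q| ^+ j by lra.
elim: j => [|j IH]; first by rewrite expr0 mulr1 add0r.
have : (digit_sum j.+1)%:R <= `|q| * ((digit_sum j)%:R + M%:R).
  rewrite -(ler_pM2r M0) [X in _ <= X]mulrAC normq -natrD -!natrM ler_nat /=.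
  rewrite -mulnA leq_mul2l; apply/orP; right.
  by rewrite mulnC -digitE leq_add2l digit_le.
by rewrite exprS; nra.
Qed.

End Digits.

(** * The test word and its path *)

Section Distorted.
Variables (G : groupType) (a t : G) (M N : nat) (sg : bool).
Variables (q : rat) (q0 : q != 0) (phi : G -> aff q0).
Hypotheses (gen : generated_by a t) (M_gt0 : (0 < M)%N) (ltMN : (M < N)%N).
Hypothesis rel : (t * a ^+ M * t^-1 = (if sg then a^-1 else a) ^+ N)%g.
Hypothesis eq_q : q * M%:R = (-1) ^+ sg * N%:R.
Hypothesis phiM : forall x y, phi (x * y)%g = (phi x * phi y)%g.
Hypotheses (phi_a : phi a = (0, 1)) (phi_t : phi t = (1, 0)).

Let normq : `|q| * M%:R = N%:R.
Proof.
have /(congr1 Num.norm) := eq_q.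
by rewrite !normrM normrX normrN1 expr1n mul1r !normr_nat.
Qed.

Let q_gt1 : 1 < `|q| := norm_gt1 M_gt0 ltMN normq.

(** If [sg] holds, each conjugation by [t] inverts the sign of the exponent, whence the parity. *)
Let signed_a j : G := if sg && odd j then (a^-1)%g else a.
Let sign_a j : rat := if sg && odd j then -1 else 1.
Let Z j : rat := sign_a j *+ digit_sum M N j.
(** A digit and its [t^-1] form one generator, so [down j] has exactly [j] letters. *)
Let letter j : G := (signed_a j ^+ digit M N j * t^-1)%g.
Let down j : seq G := [seq letter k | k <- iota 0 j].

Let rel_signed j : (t * signed_a j ^+ M * t^-1 = signed_a j.+1 ^+ N)%g.
Proof.
rewrite /signed_a /=; move: rel; case: sg => //=; case: odd => //= rel1.
by apply: invg_inj; rewrite !invgM invgK expVgn invgK mulgA rel1 expVgn.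
Qed.

Let push_t j k : (signed_a j ^+ (M * k) * t^-1 = t^-1 * signed_a j.+1 ^+ (N * k))%g.
Proof.
have conj g : (t * g ^+ k * t^-1 = (t * g * t^-1) ^+ k)%g.
  by have := conjXg g (t^-1)%g k; rewrite !conjgE invgK !mulgA.
by rewrite !expgnA -rel_signed -conj !mulgA mulVg mul1g.
Qed.

(** The next digit completes the exponent to a multiple of [M], which [push_t] moves across
    [t^-1]. *)
Let prodw_down j : prodw (down j) = (t^-1 ^+ j * signed_a j ^+ digit_sum M N j)%g.
Proof.
elim: j => [|j IH]; first by rewrite /prodw big_nil !expg0 mulg1.
rewrite /down -addn1 iotaD map_cat prodw_cat -/(down j) IH.
rewrite /prodw big_seq1 /letter add0n addn1.
rewrite mulgA -(mulgA (t^-1 ^+ j)%g) -expgnDr digitE // expgSr -!mulgA; congr (_ * _)%g.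
exact: push_t.
Qed.

Let alpha i : seq G := nseq i t ++ down i ++ (a :: invw (down i)).

Let size_down i : size (down i) = i. Proof. by rewrite size_map size_iota. Qed.

Let take_down i j : (j <= i)%N -> take j (down i) = down j.
Proof. by move=> le_ji; rewrite -map_take take_iota (minn_idPl le_ji). Qed.

Let size_alpha i : size (alpha i) = (3 * i + 1)%N.
Proof. by rewrite !size_cat /= size_invw size_down size_nseq; lia. Qed.

Let alpha_conj i : (t ^+ i * (prodw (down i) * (a * (prodw (down i))^-1)) = a * t ^+ i)%g.
Proof.
have com : commute (signed_a i ^+ digit_sum M N i)%g a.
  by apply/commute_sym/commuteX; rewrite /signed_a; case: ifP => _ //; apply/commuteV.
rewrite prodw_down invgM expVgn invgK !mulgA mulgV mul1g com -(mulgA a).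
by rewrite mulgV mulg1.
Qed.

Let prodw_alpha i : prodw (alpha i) = (a * t ^+ i)%g.
Proof. by rewrite !prodw_cat prodw_cons prodw_invw prodw_nseq alpha_conj. Qed.

Let phi_exp g k : phi (g ^+ k)%g = (phi g ^+ k)%g := morph_exp phiM g k.

Let phi_tX k : phi (t ^+ k)%g = (k%:Z, 0).
Proof. by rewrite phi_exp phi_t aff_expgX natz. Qed.

Let phi_tV : phi (t^-1)%g = (-1, 0).
Proof. by rewrite (morph_inv phiM) phi_t aff_invE /= mulr0 oppr0. Qed.

Let phi_tVX k : phi (t^-1 ^+ k)%g = (- k%:Z, 0).
Proof. by rewrite phi_exp phi_tV aff_expgX mulNrn natz. Qed.

Let phi_aV : phi (a^-1)%g = (0, -1).
Proof. by rewrite (morph_inv phiM) phi_a aff_invE /= mulr1 oppr0 expr0z. Qed.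

Let phi_signed j k : phi (signed_a j ^+ k)%g = (0, sign_a j *+ k).
Proof.
by rewrite phi_exp /signed_a /sign_a; case: ifP; rewrite ?phi_aV ?phi_a aff_expg0.
Qed.

Let phi_down i j : (j <= i)%N ->
  phi (t ^+ i * prodw (down j))%g = ((i - j)%N%:Z, q ^+ (i - j) * Z j).
Proof.
move=> le_ji; rewrite prodw_down !phiM phi_tX phi_tVX phi_signed !aff_mulE /=.
by rewrite addr0 !add0r mulrA -expfzDr // subzn.
Qed.

Let alpha_path i s : (s <= size (alpha i))%N -> exists (h : nat) (T : rat),
  phi (prodw (take s (alpha i))) = (h%:Z, T) /\ alpha_point q Z i s h T.
Proof.
move=> /prodw_take_cat[].
  rewrite size_nseq => -[le_si ->]; exists s, 0; split; last exact: AlphaUp.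
  by rewrite prodw_take_nseq // phi_tX.
rewrite size_nseq => -[{}s -> [le_s ->]]; rewrite prodw_nseq.
case: (prodw_take_cat le_s); rewrite size_down.
  move=> [le_si ->]; exists (i - s)%N, (q ^+ (i - s) * Z s).
  rewrite take_down // phi_down //; split=> //.
  by apply: (@AlphaDown _ _ _ _ _ _ s) => //; rewrite subnK.
move=> [[|r] -> [/= le_r ->]].
  exists 0%N, (Z i); rewrite {2}/prodw big_nil mulg1 phi_down // subnn expr0 mul1r.
  split=> //; apply: (@AlphaDown _ _ _ _ _ _ i) => //; first by rewrite addn0.
  by rewrite subnn expr0 mul1r.
move: le_r; rewrite ltnS size_invw size_down => le_r.
(* Past the middle letter the descent is undone: by [alpha_conj] the value is
   [a t^i down (i - r)]. *)
rewrite prodw_cons prodw_take_invw ?size_down // take_down ?leq_subr //.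
exists r, (1 + q ^+ r * Z (i - r)); split; last first.
  have le : (i - r <= i)%N by rewrite leq_subr.
  by apply: (@AlphaBack _ _ _ _ _ _ (i - r)) => //; rewrite ?subKn //; lia.
rewrite (mulgA a) (mulgA (prodw (down i))) (mulgA (t ^+ i)%g) alpha_conj.
rewrite -mulgA phiM phi_a.
by rewrite phi_down ?leq_subr // aff_mulE /= add0r expr0z mul1r subKn.
Qed.

Let word i p : seq G := alpha i ++ nseq p (t^-1)%g ++ ((a^-1)%g :: alpha i).

Let word_path i p s : (p <= i)%N -> (s <= size (word i p))%N ->
  exists (h : nat) (T : rat), phi (prodw (take s (word i p))) = (h%:Z, T) /\
    path_point q Z i p s h T.
Proof.
move=> le_pi; have pt_block r : (r <= p)%N ->
    phi (prodw (alpha i) * (t^-1 ^+ r))%g = ((i - r)%N%:Z, 1).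
  move=> le_rp; rewrite prodw_alpha !phiM phi_a phi_tX phi_tVX !aff_mulE /=.
  by rewrite !mulr0 !addr0 add0r subzn // (leq_trans le_rp).
move=> /prodw_take_cat[].
  move=> [/alpha_path[h [T [eq_phi pt]]] ->]; exists h, T; split=> //.
  exact: PathAlpha.
rewrite size_alpha => -[{}s -> [le_s ->]]; case: (prodw_take_cat le_s); rewrite size_nseq.
  move=> [le_sp ->]; exists (i - s)%N, 1; rewrite prodw_take_nseq // pt_block //.
  split=> //; apply: (@PathBlock _ _ _ _ _ _ _ s) => //.
  by rewrite subnK // (leq_trans le_sp).
move=> [[|r] -> [/= le_r ->]]; rewrite prodw_nseq.
  exists (i - p)%N, 1; rewrite [X in (_ * (_ * X))%g]/prodw big_nil mulg1 pt_block //.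
  by split=> //; apply: (@PathBlock _ _ _ _ _ _ _ p); rewrite ?addn0 ?subnK.
have [h [T [eq_phi pt]]] := alpha_path le_r.
exists (i - p + h)%N, (1 - q ^+ (i - p) + q ^+ (i - p) * T); split; last first.
  by apply: (PathBeta pt) => //; lia.
rewrite prodw_cons mulgA phiM pt_block // phiM phi_aV eq_phi !aff_mulE /=.
by rewrite add0r PoszD expr0z mul1r mulrDr mulrN1 addrA.
Qed.

(** * A generating set containing the letters of the descent *)

Let base : seq G := [:: a; t] ++ [seq (a ^+ k * t^-1)%g | k <- iota 0 M.+1]
  ++ [seq (a^-1 ^+ k * t^-1)%g | k <- iota 0 M.+1].

Let S : {fset G} := [fset g in base ++ [seq (g^-1)%g | g <- base]]%fset.

Let SP g : g \in S -> exists2 b, b \in base & g = b \/ g = (b^-1)%g.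
Proof.
rewrite in_fset mem_cat => /orP[gb|/mapP[b bb ->]]; first by exists g => //; left.
by exists b => //; right.
Qed.

Let S_base g : g \in base -> g \in S.
Proof. by move=> gb; rewrite in_fset mem_cat gb. Qed.

Let S_inv g : g \in S -> (g^-1)%g \in S.
Proof.
move=> /SP[b bb [->|->]]; last by rewrite invgK S_base.
by rewrite in_fset mem_cat; apply/orP; right; apply: map_f.
Qed.

Let aS : a \in S. Proof. by apply: S_base; rewrite !inE eqxx. Qed.
Let tS : t \in S. Proof. by apply: S_base; rewrite !inE eqxx orbT. Qed.
Let symS : symmetric_generating S := generated_sym gen aS tS S_inv.

Let letterS j : letter j \in S.
Proof.
have dM : digit M N j \in iota 0 M.+1 by rewrite mem_iota ltnS digit_le.
apply: S_base; rewrite !mem_cat /letter /signed_a; case: ifP => _.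
  by apply/orP; right; apply/orP; right; apply: (map_f _ dM).
by apply/orP; right; apply/orP; left; apply: (map_f _ dM).
Qed.

Let alphaS i : all (mem S) (alpha i).
Proof.
have downS : all (mem S) (down i) by apply/allP => _ /mapP[k _ ->]; apply: letterS.
rewrite !all_cat all_nseq downS /= tS aS orbT /= all_rev all_map.
by apply/allP => x /(allP downS) /= /S_inv.
Qed.

(** The effect of one generator; by the last conjunct, scaling costs at most one factor [nu] in the
    denominator. *)
Let small (x : aff q0) := [/\ `|x.1| <= 1, `|q ^ x.1| <= `|q|, `|x.2| <= N%:R,
  nu_integral q x.2 & nu_integral q (nu q * q ^ x.1)].

Let small_pair (h c : int) : `|h| <= 1 -> `|c| <= M%:Z ->
  small (h, c%:~R) /\ small (h, q * c%:~R).
Proof.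
move=> h1 cM; have q_int := nu_integral_q q_gt1.
have cM' : `|c%:~R| <= M%:R :> rat by rewrite -intr_norm pmulrn ler_int.
have qh : `|q ^ h| <= `|q| /\ nu_integral q (nu q * q ^ h).
  have [->|[->|->]] : h = -1 \/ h = 0 \/ h = 1 by lia.
  - rewrite exprN1 normfV nu_div_q // (le_trans _ (ltW q_gt1)) ?invf_le1 ?ltW
      ?(lt_trans ltr01) //.
    by split=> //; apply: nu_integral_int.
  - by rewrite expr0z normr1 mulr1 ltW //; split=> //; apply: nu_integral_int.
  - by rewrite expr1z; split=> //; apply: nu_integralM => //; apply: nu_integral_int.
split; split=> //=; try by case: qh.
- by rewrite (le_trans cM') // ler_nat ltnW.
- exact: nu_integral_int.
- by rewrite normrM -normq ler_wpM2l.
- by apply: nu_integralM => //; apply: nu_integral_int.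
Qed.


Let small_S g : g \in S -> small (phi g).
Proof.
have small1 h c : `|h| <= 1 -> `|c| <= M%:Z -> small (h, c%:~R).
  by move=> h1 cM; case: (small_pair h1 cM).
have small2 c : `|c| <= M%:Z -> small (1, q * c%:~R).
  by move=> cM; case: (@small_pair 1 _ _ cM).
move=> /SP[b]; rewrite mem_cat => /orP[|]; first rewrite !inE => /orP[]/eqP->.
- case=> ->; rewrite ?phi_aV ?phi_a.
    by apply: (small1 0 1); lia.
  by apply: (small1 0 (-1)); lia.
- by case=> ->; rewrite ?phi_tV ?phi_t; [apply: (small1 1 0)|apply: (small1 (-1) 0)]; lia.
have small_down c g' : `|c| <= M%:Z -> phi g' = (0, c%:~R) ->
    g = (g' * t^-1)%g \/ g = ((g' * t^-1)^-1)%g -> small (phi g).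
  move=> cM eq_phi [->|->]; rewrite ?(morph_inv phiM) phiM eq_phi phi_tV aff_mulE /=.
    by rewrite add0r expr0z mul1r addr0; apply: small1.
  rewrite aff_invE /= add0r opprK expr0z mul1r addr0 expr1z -mulrN -rmorphN /=.
  by apply: small2; rewrite normrN.
rewrite mem_cat => /orP[]/mapP[k]; rewrite mem_iota ltnS /= => le_k ->.
- by apply: (@small_down k%:Z); [lia|rewrite phi_exp phi_a aff_expg0 pmulrn].
- apply: (@small_down (- k%:Z)); first by lia.
  by rewrite phi_exp phi_aV aff_expg0 mulNrn mulrNz.
Qed.

Let B := `|q| + N%:R + 1.

Let bound k (x : aff q0) := [/\ `|x.1| <= k%:Z, `|x.2| <= B ^+ k - 1
  & nu_integral q (nu q ^+ k * x.2)].

(** A generator takes a translation [z] to one of size at most [N + |q| |z|], whence the base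
    [B]. *)
Let word_length_bound g : bound (word_length S g) (phi g).
Proof.
apply: word_length_morph g => //.
  by split; rewrite /= ?normr0 ?expr0 ?subrr // mulr0; apply: (nu_integral_int _ 0).
move=> k s x /small_S[s1 s2 s3 s4 s5] [x1 x2 x3]; rewrite aff_mulE; split=> /=.
- by lia.
- have B1 : 1 <= B ^+ k by rewrite exprn_ege1 // /B lerDr addr_ge0.
  apply: le_trans (ler_normD _ _) _; rewrite normrM.
  have le1 : `|q ^ (phi s).1| * `|x.2| <= `|q| * (B ^+ k - 1) by apply: ler_pM.
  rewrite exprS {1}/B; have : 0 <= `|q| := normr_ge0 q; have : 0 <= N%:R :> rat by [].
  by move: B1 le1 s3; nra.
- have -> : nu q ^+ k.+1 * ((phi s).2 + q ^ (phi s).1 * x.2) =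
      nu q ^+ k.+1 * (phi s).2 + (nu q * q ^ (phi s).1) * (nu q ^+ k * x.2).
    by rewrite exprS; ring.
  apply: nu_integralD; apply: nu_integralM => //.
  exact/nu_integralX/nu_integral_int.
Qed.

(** The quotient of the points is scaled by [q^-h1] and its inverse by [q^-h2], so the two bounds
    control [h1] and [h2] separately. *)
Let near_of_bound e k (h1 h2 : nat) T1 T2 : B <= `|q| ^+ e ->
  bound k (((h1%:Z, T1) : aff q0)^-1 * ((h2%:Z, T2) : aff q0))%g ->
  bound k (((h2%:Z, T2) : aff q0)^-1 * ((h1%:Z, T1) : aff q0))%g ->
  near q e k h1 h2 (T2 - T1).
Proof.
move=> leB; rewrite !aff_divE => -[/= le1 arch1 pad1] [/= _ arch2 pad2].
have qpos : 0 < `|q| := lt_trans ltr01 q_gt1.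
have archX h r D : `|q ^ (- h%:Z) * D| <= B ^+ k - 1 -> `|q| ^+ r <= `|q| ^+ e * `|D| ->
    (r <= e + h + e * k)%N.
  rewrite normrM -exprnN normfV normrX mulrC ler_pdivrMr ?exprn_gt0 // => leD leQ.
  rewrite leqNgt; apply/negP => lt_r.
  have leBk : B ^+ k <= `|q| ^+ (e * k).
    by rewrite exprM lerXn2r // ?nnegrE ?exprn_ge0 // /B !addr_ge0.
  have : `|D| < `|q| ^+ (e * k) * `|q| ^+ h.
    apply: le_lt_trans leD _; rewrite ltr_pM2r ?exprn_gt0 //.
    by apply: lt_le_trans leBk; rewrite ltrBlDr ltrDl.
  rewrite -exprD -(ltr_pM2l (exprn_gt0 e qpos)) -exprD => /(le_lt_trans leQ).
  by rewrite ltr_eXn2l // => lt_r2; move: lt_r lt_r2; clear; lia.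
have opp : T1 - T2 = - (T2 - T1) by rewrite opprB.
split; [by move: le1; clear; lia|by move: le1; clear; lia| |].
  move=> r leQ; split; first exact: archX leQ.
  by apply: (@archX _ _ (T1 - T2)) => //; rewrite opp normrN.
move=> r c y c1 int_y eq_D; split; first by apply: nu_pole c1 int_y _; rewrite -?eq_D.
apply: (@nu_pole _ q_gt1 _ _ _ (- c) (- y)); rewrite ?normrN //.
  exact: nu_integralN.
by rewrite rmorphN /= mulrN -opprD mulrN -eq_D -opp.
Qed.

Lemma distorted_not_QCF (R : realType) : ~ QCF R G.
Proof.
set K := `|q| * M%:R / (`|q| - 1).
have K0 : 0 <= K by rewrite divr_ge0 ?mulr_ge0 // subr_ge0 ltW.
have B0 : 0 <= B by rewrite /B !addr_ge0.
have [e le_e] := exists_expr_ge (`|q| / (`|q| - 1) + 2 * (K + 1) + B) q_gt1.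
have qq0 : 0 <= `|q| / (`|q| - 1) by rewrite divr_ge0 // subr_ge0 ltW.
have e1 : `|q| <= `|q| ^+ e * (`|q| - 1).
  by rewrite -ler_pdivrMr ?subr_gt0 //; lra.
have e2 : 2 * (K + 1) <= `|q| ^+ e by lra.
have e3 : B <= `|q| ^+ e by lra.
have normZ j : `|Z j| = (digit_sum M N j)%:R.
  by rewrite /Z normrMn /sign_a; case: ifP; rewrite ?normrN normr1.
have Z_nu j : exists2 y, nu_integral q y & Z j = nu q * y.
  (* Up to sign, [N] is [q * M], and [q] is [nu] times the integral [q / nu]. *)
  have [y int_y eq_y] : exists2 y, nu_integral q y & N%:R = nu q * y.
    exists ((-1) ^+ sg * (M%:R * (q / nu q))).
      apply: nu_integralM; first by apply/nu_integralX/(nu_integral_int _ (-1)).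
      by apply: nu_integralM; [apply: (nu_integral_int _ M%:Z)|apply: nu_integral_q_nu].
    have eqM : nu q * ((-1) ^+ sg * (M%:R * (q / nu q))) = (-1) ^+ sg * (q * M%:R).
      by have := nu_neq0 q_gt1 => n0; field.
    by rewrite eqM eq_q mulrA -expr2 sqrr_sign mul1r.
  case: j => [|j].
    by exists 0; [apply: (nu_integral_int _ 0)|rewrite /Z mulr0 /= mulr0n].
  exists (sign_a j.+1 * ((digit_sum M N j %/ M).+1%:R * y)).
    apply: nu_integralM; last first.
      by apply: nu_integralM => //; apply: (nu_integral_int _ (Posz _)).
    rewrite /sign_a; case: ifP => _; first exact: (nu_integral_int _ (-1)).
    exact: (nu_integral_int _ 1).
  transitivity (sign_a j.+1 * (N%:R * (digit_sum M N j %/ M).+1%:R)).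
    by rewrite -natrM mulr_natr.
  by rewrite eq_y; ring.
(* The bound in [path_near] is then [c * k + c]. *)
pose c := (20 * (e + 1))%N.
apply: (@not_QCF_block G S symS R c c (t^-1)%g) => [|//|p p_gt0]; rewrite {}/c.
- by rewrite muln_gt0 addn1.
- exact: S_inv.
(* By the last condition, words of length [4 * i + 1] are too long for elements of length at most
   1. *)
have [i [le_p le_2p le_pe lt_i]] : exists i, [/\ p <= i, 2 * p <= i, p + e <= i
    & 40 * (e + 1) < 4 * i + 1]%N.
  by exists (2 * p + 10 * (e + 1))%N; clear; split; lia.
have le_wl g : g \in S -> (word_length S g <= 1)%N.
  by move=> gS; have := @word_length_le _ S [:: g]; rewrite /= gS /prodw big_seq1; apply.
exists (alpha i), ((a^-1)%g :: alpha i); rewrite /= !alphaS S_inv // andTb; split=> //.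
- rewrite -/(word i p) => s1 s2 le_s le_s2.
  have [h1 [T1 [eq1 pt1]]] := @word_path i p s1 le_p (leq_trans le_s le_s2).
  have [h2 [T2 [eq2 pt2]]] := @word_path i p s2 le_p le_s2.
  set g := (_^-1 * _)%g.
  have bd := word_length_bound g; have := word_length_bound (g^-1)%g.
  rewrite word_length_inv // /g invgM invgK.
  move: bd; rewrite /g !phiM !(morph_inv phiM) eq1 eq2 => bd1 bd2.
  have := path_near _ _ _ _ Z_nu e1 e2 p_gt0 le_2p le_pe le_s pt1 pt2
    (near_of_bound e3 bd1 bd2).
  move: (word_length _ _) => k; move=> near_le; apply: leq_trans (near_le q_gt1 _ _ _) _.
  + by rewrite /Z.
  + by move=> j j_gt0; rewrite normZ; apply: digit_sum_ge.
  + by move=> j; rewrite normZ; apply: digit_sum_le.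
  + by clear; lia.
- exists i; rewrite prodw_cat prodw_alpha prodw_nseq expVgn mulgK.
  have := le_wl a aS; rewrite size_cat size_alpha size_nseq.
  by move: lt_i (word_length _ _); clear; nia.
- exists i; rewrite prodw_cat prodw_cons prodw_alpha prodw_nseq mulKg expVgn mulVg.
  have := @word_length_le _ S [::] isT; rewrite /prodw big_nil /=.
  rewrite size_cat /= size_alpha size_nseq leqn0 => /eqP->.
  by move: lt_i; clear; lia.
Qed.

End Distorted.

(** * Baumslag--Solitar groups *)

(** After inverting both sides if necessary, only [|m|], [|n|] and whether the signs differ
    matter. *)
Definition twist_rel (G : groupType) (M N : nat) (sg : bool) (a t : G) : Prop :=
  (t * a ^+ M * t^-1 = (if sg then a^-1 else a) ^+ N)%g.

Lemma twist_relV (G : groupType) M N sg (a t : G) :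
  twist_rel M N sg a t -> twist_rel N M sg a (t^-1)%g.
Proof.
rewrite /twist_rel invgK; case: sg => rel.
  apply: invg_inj; rewrite !invgM -!expVgn !invgK mulgA -[(a^-1 ^+ N)%g]rel.
  by rewrite !mulgA mulVg mul1g mulgVK.
by rewrite -rel !mulgA mulVg mul1g mulgVK.
Qed.

Lemma generated_byV (G : groupType) (a t : G) :
  generated_by a t -> generated_by a (t^-1)%g.
Proof.
move=> gen g; have [w ->] := gen g; exists [seq (p.1, p.1 (+) p.2) | p <- w].
rewrite big_map; apply: eq_bigr => -[[] []] _ //.
by rewrite /letter_val /= invgK.
Qed.

(** Conjugation by [t] fixes or inverts [a^N], so conjugation by [t^2] fixes it. *)
Lemma twist_rel_commute (G : groupType) N (sg : bool) (a t : G) :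
  twist_rel N N sg a t -> commute (t ^+ 2)%g (a ^+ N)%g.
Proof.
rewrite /twist_rel => rel; rewrite /commute expg2.
have ta : (t * a ^+ N = (if sg then a^-1 else a) ^+ N * t)%g by rewrite -rel mulgVK.
have ta' : (t * (if sg then a^-1 else a) ^+ N = a ^+ N * t)%g.
  case: sg ta {rel} => // ta; rewrite expVgn; apply: (canLR (mulgK _)).
  by rewrite -mulgA ta expVgn mulgA mulgV mul1g.
by rewrite -mulgA ta mulgA ta' mulgA.
Qed.

Section BaumslagSolitar.
Variables (m n : int).

Let sg := (m < 0) (+) (n < 0).
Let gena : BS m n := pres_class _ [:: (bs_a, false)].
Let gent : BS m n := pres_class _ [:: (bs_t, false)].

Lemma bs_relP (G : groupType) (f : bool -> G) :
  (\prod_(p <- word_pow bs_t 1 ++ word_pow bs_a m ++ word_pow bs_t (-1)) letter_val f p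
    = \prod_(p <- word_pow bs_a n) letter_val f p)%g
  <-> twist_rel `|m| `|n| sg (f bs_a) (f bs_t).
Proof.
have prod_pow x k : (\prod_(p <- word_pow x k) letter_val f p
    = (if k < 0 then (f x)^-1 else f x) ^+ `|k|%N)%g.
  rewrite /word_pow; elim: `|k|%N => [|l IH]; first by rewrite big_nil.
  by rewrite /= big_cons IH expgS; case: ifP.
rewrite !big_cat /= !prod_pow /= !expg1 /twist_rel /sg mulgA.
have inv_iff (y x z : G) : (y * x^-1 * y^-1 = z^-1 <-> y * x * y^-1 = z)%g.
  have -> : (y * x^-1 * y^-1 = (y * x * y^-1)^-1)%g by rewrite !invgM invgK mulgA.
  by split=> [/invg_inj|->].
case: (m < 0); case: (n < 0) => //=; rewrite ?expVgn //.
by rewrite -[X in _ = X <-> _]invgK.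
Qed.

Lemma bs_gen : generated_by gena gent.
Proof.
move=> g; rewrite -[g]pres_classK pres_class_prod; exists (repr g).
by apply: eq_bigr => -[[] b] _.
Qed.

Lemma bs_twist : twist_rel `|m| `|n| sg gena gent.
Proof.
apply: (iffLR (@bs_relP _ (fun x => pres_class (bs_rel m n) [:: (x, false)]))).
by rewrite -!pres_class_prod; apply/pres_classP/pres_eqn.
Qed.

Lemma bs_hom (G : groupType) (x y : G) : twist_rel `|m| `|n| sg x y ->
  exists phi : BS m n -> G, [/\ forall g h, phi (g * h)%g = (phi g * phi h)%g,
    phi gena = x & phi gent = y].
Proof.
move=> rel; pose f (b : bool) := if b then y else x.
pose phi (g : BS m n) := (\prod_(p <- repr g) letter_val f p)%g.
have phiE w : phi (pres_class _ w) = (\prod_(p <- w) letter_val f p)%g.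
  apply: (@pres_eq_val _ (bs_rel m n)); last first.
    by apply/pres_classP; rewrite pres_classK.
  by move=> _ _ []; apply/bs_relP.
exists phi; split; rewrite ?phiE ?big_seq1 //.
move=> g h; rewrite -[g]pres_classK -[h]pres_classK -[(_ * _)%g]/(pres_mul _ _) pres_mulE.
by rewrite !phiE big_cat.
Qed.

End BaumslagSolitar.

(** Conjugation by [x |-> q x] multiplies translations by [q]. *)
Lemma aff_twist (M N : nat) (sg : bool) (q : rat) (q0 : q != 0) :
  q * M%:R = (-1) ^+ sg * N%:R ->
  twist_rel M N sg ((0, 1) : aff q0) ((1, 0) : aff q0).
Proof.
move=> eq_q; rewrite /twist_rel aff_invE /=.
rewrite (_ : (if sg then _ else _) = ((0, (-1) ^+ sg) : aff q0)); last first.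
  by case: sg {eq_q}; rewrite // aff_invE /= oppr0 expr0z mul1r.
rewrite aff_expg0 aff_expg0 !aff_mulE /= !(mulr0, oppr0, addr0, add0r) expr1z.
by rewrite -[1 *+ M]/(M%:R) eq_q mulr_natr.
Qed.

Theorem theorem1p5 (R : realType) (m n : int) (hm : m != 0) (hn : n != 0) :
  ~ QCF R (BS m n).
Proof.
set M := `|m|%N; set N := `|n|%N; set sg := (m < 0) (+) (n < 0).
have M_gt0 : (0 < M)%N by rewrite absz_gt0.
have N_gt0 : (0 < N)%N by rewrite absz_gt0.
have ratio (A B : nat) : (0 < A)%N -> (0 < B)%N ->
    exists2 q : rat, q != 0 & q * A%:R = (-1) ^+ sg * B%:R.
  move=> A_gt0 B_gt0; have A0 : A%:R != 0 :> rat by rewrite pnatr_eq0 -lt0n.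
  exists ((-1) ^+ sg * B%:R / A%:R); last by rewrite divfK.
  by rewrite !mulf_neq0 ?invr_neq0 ?signr_eq0 // pnatr_eq0 -lt0n.
have gen := @bs_gen m n; have rel := bs_twist m n.
case: (ltngtP M N) => [lt_MN|lt_NM|eq_MN].
- have [q q0 eq_q] := ratio M N M_gt0 N_gt0.
  have [phi [phiM phi_a phi_t]] := bs_hom (aff_twist q0 eq_q).
  exact: distorted_not_QCF gen M_gt0 lt_MN rel eq_q phiM phi_a phi_t R.
(* Here [t] is replaced by [t^-1], both in the group and in its affine image. *)
- have [q q0 eq_q] := ratio N M N_gt0 M_gt0.
  have [phi [phiM phi_a phi_t]] := bs_hom (twist_relV (aff_twist q0 eq_q)).
  apply: (distorted_not_QCF (generated_byV gen) N_gt0 lt_NM (twist_relV rel) eq_q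
    phiM phi_a).
  by rewrite (morph_inv phiM) phi_t invgK.
- have [q q0 eq_q] := ratio M N M_gt0 N_gt0.
  have [phi [phiM phi_a phi_t]] := bs_hom (aff_twist q0 eq_q).
  have q2 : q ^+ 2 = 1.
    have M0 : M%:R != 0 :> rat by rewrite pnatr_eq0 -lt0n.
    by move: eq_q; rewrite -eq_MN => /(mulIf M0) ->; rewrite sqrr_sign.
  apply: undistorted_not_QCF gen M_gt0 _ phiM phi_a phi_t q2 R.
  by rewrite -/M -/N -eq_MN in rel; apply: twist_rel_commute rel.
Qed.
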